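(* For each $n$ let $1\le p(n)\le n$ be an integer, let $A$ be an $n\times p(n)$ matrix with independent standard real Gaussian entries, and let $W_{n,p(n)}^{L,1}:=A^{t}A$ (the Laguerre ensemble with $\beta=1$). Put $$Z_{n,p(n)}^L:=\frac{\log\det W_{n,p(n)}^{L,1}-\mathbb{E}(\log\det W_{n,p(n)}^{L,1})}{\sqrt{\mathbb{V}(\log\det W_{n,p(n)}^{L,1})}}$$ and let $N$ be a standard normally distributed random variable. Let $k$ be an even positive integer. (a) If $p(n)=o(n)$, or $p(n)\sim c\,n$ for a fixed $c\in(0,1)$, as $n\to\infty$, then there is a constant $C_1(k)$, not depending on $n$, such that for all sufficiently large $n$ $$\bigl|\mathbb{E}\bigl((Z_{n,p(n)}^L)^k\bigr)-\mathbb{E}(N^k)\bigr|\le C_1(k)\,\frac1{p(n)\,n}.$$ (b) If $n-p(n)=o(n)$ as $n\to\infty$ (including the case $p(n)=n$), then there is a constant $C_1(k)$, not depending on $n$, such that for all sufficiently large $n$ $$\bigl|\mathbb{E}\bigl((Z_{n,p(n)}^L)^k\bigr)-\mathbb{E}(N^k)\bigr|\le C_1(k)\,\frac1{\log\frac{n}{n-p(n)+1}}.$$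
   Context: $\mathbb{V}$ denotes variance. The eigenvalues of $W^{L,1}_{n,p(n)}$ have joint density on $(0,\infty)^{p(n)}$ proportional to $\prod_{1\le j<k\le p(n)}|\lambda_j-\lambda_k|\prod_{k=1}^{p(n)}\lambda_k^{\frac12(n-p(n)+1)-1}e^{-\lambda_k/2}$. *)

(* Defs.v *)
From HB Require Import structures.
From mathcomp Require Import all_boot all_order all_algebra.
From mathcomp Require Import all_classical all_reals all_analysis.

Set Implicit Arguments.
Unset Strict Implicit.
Unset Printing Implicit Defensive.

Import Order.TTheory GRing.Theory Num.Theory.
Import numFieldNormedType.Exports.

Local Open Scope classical_set_scope.
Local Open Scope ring_scope.

Definition mutually_independent (d : measure_display) (T : measurableType d)
    (R : realType) (P : probability T R) (I : finType)
    (X : I -> {RV P >-> R}) : Prop :=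
  forall (J : {set I}) (B : I -> set R),
    (forall i, i \in J -> measurable (B i)) ->
    P (\bigcap_(i in [set` J]) (X i @^-1` B i)) =
      (\prod_(i in J) P (X i @^-1` B i))%E.

Definition standard_normal (d : measure_display) (T : measurableType d)
    (R : realType) (P : probability T R) (X : {RV P >-> R}) : Prop :=
  forall B : set R, measurable B -> distribution P X B = normal_prob 0 1 B.

Definition standard_gaussian_matrix (d : measure_display)
    (T : measurableType d) (R : realType) (P : probability T R) (n m : nat)
    (A : 'I_n -> 'I_m -> {RV P >-> R}) : Prop :=
  mutually_independent (fun ij : 'I_n * 'I_m => A ij.1 ij.2) /\
  forall i j, standard_normal (A i j).

Definition laguerre (d : measure_display) (T : measurableType d)
    (R : realType) (P : probability T R) (n m : nat)
    (A : 'I_n -> 'I_m -> {RV P >-> R}) (w : T) : 'M[R]_m :=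
  let M := \matrix_(i < n, j < m) A i j w in M^T *m M.

(* When m <= n and A is standard Gaussian the determinant is almost surely
   positive, so the library convention ln x = 0 for x <= 0 only affects a null
   set. *)
Definition log_det_laguerre (d : measure_display) (T : measurableType d)
    (R : realType) (P : probability T R) (n m : nat)
    (A : 'I_n -> 'I_m -> {RV P >-> R}) (w : T) : R :=
  ln (\det (laguerre A w)).

Definition standardize (d : measure_display) (T : measurableType d)
    (R : realType) (P : probability T R) (X : T -> R) (w : T) : R :=
  (X w - fine 'E_P[X]%E) / Num.sqrt (fine 'V_P[X]%E).

Definition ZL (d : measure_display) (T : measurableType d)
    (R : realType) (P : probability T R) (n m : nat)
    (A : 'I_n -> 'I_m -> {RV P >-> R}) : T -> R :=
  standardize P (log_det_laguerre A).

(* Main.v *)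
Require Import Defs.
From HB Require Import structures.
From mathcomp Require Import all_boot all_order all_algebra.
From mathcomp Require Import ring lra zify.
From mathcomp Require Import all_classical all_reals all_analysis.
From mathcomp Require Import measurable_realfun.

Set Implicit Arguments.
Unset Strict Implicit.
Unset Printing Implicit Defensive.

Import Order.TTheory GRing.Theory Num.Theory.
Import numFieldNormedType.Exports.

Local Open Scope classical_set_scope.
Local Open Scope ring_scope.

(* Rotating the first column onto a multiple of the first basis vector shows that
   [det (A^T A)] is distributed as a product of independent chi-square variables
   with [n - p + 1], ..., [n] degrees of freedom, so the cumulants of its logarithm
   are sums of those of [log chi^2_m].  Integration by parts gives
   [E f(chi^2_(m+2))] from [E f(chi^2_m)]; on the cumulants this reads
   [k_(m+2)(j) = k_m(j) + (-1)^j (2/m)^(j+1)], where [k_m(j)] is the cumulant of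
   order [j + 1] divided by [j!].  As [k_m(j)] tends to [0] for [j > 0], it is
   [O(m^-j)], and the variance [k_m(1)] is at least [2/m].  With [a = n - p + 1]
   and [V] the variance of [log det], the standardized cumulant of order [j + 1] is
   thus [O((a sqrt V)^(-(j-1)))], and an even moment is within [O(1 / (a^2 V))] of the
   Gaussian one, because the skewness enters it at least twice.  Finally
   [V >= 2 (1/a + ... + 1/n)], which is at least [2 p / n] and at least
   [2 log (n / a)]. *)

(** The recursion in m leaves the cumulants undetermined up to initial values; the limit k_m(j) -> 0
    takes the place of a closed form through digamma functions. It comes from ln(y)^(2i) <= C (y +
    1/y - 2) at y = chi^2_m / m, where the right-hand side has mean 2C / (m - 2): all moments of
    log(chi^2_m / m), hence all cumulants with j > 0, are O(m^(-1/2)). This weak rate suffices,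
    since a sequence that tends to 0 and decreases along m -> m + 2 is nonnegative; applied to the
    difference with an explicit power of 1/m it gives the true order. Cumulants are formal, defined
    from moment sequences by a recursion, so no generating function has to converge. Independence is
    used by resampling: drawing part of a Gaussian family from a second copy turns conditioning into
    Fubini's theorem. Rotations occur only in coordinate planes and with nonzero cosine, which is
    enough because the first entry of a Gaussian column is almost surely nonzero. *)

(** * Cumulant sequences *)

(* The relation [(log M)' = K] between exponential generating functions, written
   coefficientwise: if [m i = E X^i / i!] then [K j] is the cumulant of order
   [j + 1] divided by [j!]. *)
Definition cumulants {R : pzRingType} (K m : nat -> R) : Prop :=
  m 0%N = 1 /\
  forall i, i.+1%:R * m i.+1 = \sum_(j < i.+1) K j * m (i - j)%N.

Definition cauchy_prod {R : pzRingType} (a b : nat -> R) (i : nat) : R :=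
  \sum_(j < i.+1) a j * b (i - j)%N.

Lemma coef_poly_mul (R : comNzRingType) (N l : nat) (a b : nat -> R) :
  (l < N)%N ->
  (\poly_(i < N) a i * \poly_(i < N) b i)`_l = cauchy_prod a b l.
Proof.
move=> lN; rewrite coefM; apply: eq_bigr => j _.
by rewrite !coef_poly !ifT//; have := ltn_ord j; lia.
Qed.

(** The logarithmic derivative turns products into sums: (ab)' = a'b + ab' = (K + L)ab. On
    truncations to polynomials this is [derivM]. *)
Lemma cumulantsD (R : comNzRingType) (K L a b : nat -> R) :
  cumulants K a -> cumulants L b ->
  cumulants (fun j => K j + L j) (cauchy_prod a b).
Proof.
move=> [a0 Ka] [b0 Lb]; split.
  by rewrite /cauchy_prod big_ord_recl big_ord0 /= a0 b0 mulr1 addr0.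
(* Only coefficients up to degree i + 1 enter, so truncating at i + 3 loses nothing. *)
move=> i; set N := i.+3.
pose A := \poly_(l < N) a l; pose B := \poly_(l < N) b l.
pose KK := \poly_(l < N) K l; pose LL := \poly_(l < N) L l.
have AB l : (l < N)%N -> (A * B)`_l = cauchy_prod a b l by exact: coef_poly_mul.
rewrite -AB ?ltnS// mulrC mulr_natr -coef_deriv derivM coefD.
have EA l : (l < i.+1)%N -> (A^`())`_l = (KK * A)`_l.
  move=> li; rewrite coef_deriv coef_poly ifT; last by rewrite /N; lia.
  rewrite -mulr_natl Ka -/(cauchy_prod K a l) coef_poly_mul//.
  by rewrite /N; lia.
have EB l : (l < i.+1)%N -> (B^`())`_l = (LL * B)`_l.
  move=> li; rewrite coef_deriv coef_poly ifT; last by rewrite /N; lia.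
  rewrite -mulr_natl Lb -/(cauchy_prod L b l) coef_poly_mul//.
  by rewrite /N; lia.
have -> : (A^`() * B)`_i = (KK * (A * B))`_i.
  by rewrite mulrA !coefM; apply: eq_bigr => j _; rewrite EA.
have -> : (A * B^`())`_i = (LL * (A * B))`_i.
  rewrite mulrCA !coefM; apply: eq_bigr => j _; rewrite EB//.
  by have := ltn_ord j; lia.
rewrite -coefD -mulrDl coefM; apply: eq_bigr => j _.
have jN := ltn_ord j.
rewrite AB; last by rewrite /N; lia.
have jN' : (j < N)%N by exact: leq_trans jN (leq_trans (leqnSn _) (leqnSn _)).
by rewrite coefD !coef_poly jN'.
Qed.

Lemma eq_cumulants (R : pzRingType) (K L a b : nat -> R) :
  K =1 L -> a =1 b -> cumulants K a -> cumulants L b.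
Proof.
move=> KL ab [a0 Ka]; split; first by rewrite -ab.
by move=> i; rewrite -ab Ka; apply: eq_bigr => j _; rewrite KL ab.
Qed.

(** Since [m 0 = 1], the relation at index [i] can be solved for [K i] in terms of all earlier
    values. Hence [F n] builds the list of the first [n] values, and [nF] says that later lists
    extend earlier ones. *)
Lemma cumulants_exists (R : pzRingType) (m : nat -> R) : m 0%N = 1 ->
  exists K, cumulants K m.
Proof.
move=> m0.
pose nxt (s : seq R) :=
  (size s).+1%:R * m (size s).+1 - \sum_(j < size s) s`_j * m (size s - j)%N.
pose F n := iter n (fun s => rcons s (nxt s)) [::].
have sF n : size (F n) = n by elim: n => //= n IH; rewrite size_rcons IH.
have nF n j k : (j < n)%N -> (F (n + k)%N)`_j = (F n)`_j.
  move=> jn; elim: k => [|k IH]; first by rewrite addn0.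
  by rewrite addnS /= nth_rcons sF ifT// (leq_trans jn)// leq_addr.
exists (fun j => (F j.+1)`_j); split => // i.
rewrite big_ord_recr /= nth_rcons sF ltnn eqxx subnn m0 mulr1 /nxt sF.
rewrite addrC -addrA [- _ + _]addrC; apply/esym/eqP.
rewrite -subr_eq0 [i.+1%:R * _ + _]addrC addrK subr_eq0; apply/eqP.
apply: eq_bigr => j _; congr (_ * _).
have jn := ltn_ord j.
by have := nF j.+1 j (i - j.+1)%N (ltnSn j); rewrite (subnKC jn) => ->.
Qed.

Lemma cumulants_unique (R : pzRingType) (K L a : nat -> R) :
  cumulants K a -> cumulants L a -> K =1 L.
Proof.
move=> [a0 Ka] [_ La]; elim/ltn_ind => i IH.
have := Ka i; rewrite La !big_ord_recr/= subnn a0 !mulr1.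
under eq_bigr => j _ do rewrite -IH//.
by move/addrI.
Qed.

Lemma cumulants_scale (R : fieldType) (s : R) (K m : nat -> R) :
  s != 0 -> cumulants K m ->
  cumulants (fun j => K j / s ^+ j.+1) (fun i => m i / s ^+ i).
Proof.
move=> s0 [m0 Km]; split; first by rewrite m0 expr0 divr1.
move=> i; rewrite mulrA Km mulr_suml; apply: eq_bigr => j _.
have E : s ^+ i.+1 = s ^+ j.+1 * s ^+ (i - j).
  by rewrite -exprD; congr (_ ^+ _); have := ltn_ord j; lia.
by rewrite E invfM mulrACA.
Qed.

(** The generating function is 1 + x t, with logarithmic derivative x / (1 + x t). With x = 2/m it
    is the factor gained by log chi^2_m when m increases by 2. *)
Lemma cumulants_one_plus (R : pzRingType) (x : R) :
  cumulants (fun j => (-1) ^+ j * x ^+ j.+1)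
    (fun i => if i == 0%N then 1 else if i == 1%N then x else 0).
Proof.
split=> // -[|i] /=; first by rewrite big_ord_recl big_ord0 /= addr0 mulr1 !mul1r.
rewrite mulr0 !big_ord_recr/= big1 ?add0r.
  rewrite subnn /= mulr1 subSnn /= -mulrA -exprSr -mulrDl exprS mulN1r subrr.
  by rewrite mul0r.
move=> j _; have ji := ltn_ord j.
by case E : (i.+1 - j)%N => [|[|?]]/=; [lia|lia|rewrite mulr0].
Qed.

(** The case of the constant [c], with generating function exp(c t): adding a constant moves only
    the cumulant of index 0. *)
Lemma cumulants_exp (R : numFieldType) (c : R) :
  cumulants (fun j => if j == 0%N then c else 0) (fun i => c ^+ i / i`!%:R).
Proof.
split; first by rewrite expr0 fact0 divr1.
move=> i; rewrite big_ord_recl /= big1 ?addr0; last by move=> j _; rewrite mul0r.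
rewrite subn0 factS natrM invfM exprS.
have n0 : (i.+1%:R : R) != 0 by rewrite pnatr_eq0.
rewrite [X in _ * X]mulrACA mulrA mulrCA mulrA.
by field; rewrite pnatr_eq0 -lt0n fact_gt0 /= addrC natr1.
Qed.

Lemma cumulants0 (R : pzRingType) :
  cumulants (fun=> 0 : R) (fun i => (i == 0%N)%:R).
Proof. by split=> // i; rewrite mulr0 big1// => j _; rewrite mul0r. Qed.

(* A standardized variable has [k 0 = 0] and [k 1 = 1]; if its higher cumulants
   are [O(delta^(j-1))], the skewness enters an even moment only multiplied by
   an odd moment, so that the error is quadratic in [delta]. *)
Lemma moments_near_normal (R : realFieldType) (c g : nat -> R) :
  (forall j, 0 <= c j) -> cumulants (fun j => (j == 1%N)%:R) g ->
  forall i, exists2 C : R, 0 <= C &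
  forall (delta : R) (k z : nat -> R), 0 <= delta <= 1 ->
    k 0%N = 0 -> k 1%N = 1 ->
    (forall j, (2 <= j)%N -> `|k j| <= c j * delta ^+ j.-1) ->
    cumulants k z ->
    `|z i| <= C /\
    if odd i then `|z i| <= C * delta else `|z i - g i| <= C * delta ^+ 2.
Proof.
move=> c0 [g0 Hg].
have Hg2 i : i.+2%:R * g i.+2 = g i.
  by rewrite Hg !big_ord_recl/= mul0r add0r mul1r subn1 /= big1 ?addr0// => j _;
    rewrite mul0r.
elim/ltn_ind => i IH.
(* One constant for all indices below [i]; the sum of the individual constants serves as a
   maximum. *)
have {}IH : exists2 C : R, 0 <= C & forall l, (l < i)%N ->
    forall (delta : R) (k z : nat -> R), 0 <= delta <= 1 ->
    k 0%N = 0 -> k 1%N = 1 ->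
    (forall j, (2 <= j)%N -> `|k j| <= c j * delta ^+ j.-1) ->
    cumulants k z ->
    `|z l| <= C /\
    if odd l then `|z l| <= C * delta else `|z l - g l| <= C * delta ^+ 2.
  elim: i IH => [|i IHi] IH; first by exists 0.
  have [l li|C C0 HC] := IHi; first by apply: IH; rewrite ltnW.
  have [C' C'0 HC'] := IH i (ltnSn i).
  exists (C + C'); first exact: addr_ge0.
  move=> l; rewrite ltnS leq_eqVlt => li delta k z d01 k0 k1 kj kz.
  have /andP[d0 d1] := d01.
  have [D [D0 DC [H1 H2]]] : exists D, [/\ 0 <= D, D <= C + C' & `|z l| <= D /\
    if odd l then `|z l| <= D * delta else `|z l - g l| <= D * delta ^+ 2].
    case/orP: li => [/eqP->|li].
      by exists C'; split=> //; [rewrite lerDr|apply: HC' kz].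
    by exists C; split=> //; [rewrite lerDl|apply: HC kz].
  split; first exact: le_trans H1 _.
  by case: ifP H2 => _ H2; apply: le_trans H2 _; rewrite ler_wpM2r// exprn_ge0.
case: IH => C C0 HC.
case: i HC => [|[|i]] HC.
- exists 1 => // delta k z _ _ _ _ [z0 _]; rewrite z0 g0 subrr normr0 normr1.
  by split=> //=; rewrite mul1r sqr_ge0.
- exists 0 => // delta k z /andP[d0 _] k0 k1 kj [z0 zk].
  have := zk 0%N; rewrite mul1r big_ord1 k0 mul0r => ->.
  by split; rewrite /= normr0 ?mul0r.
pose S := \sum_(j < i.+2) c j.
have S0 : 0 <= S by apply: sumr_ge0.
exists (C + S * C); first by rewrite addr_ge0// mulr_ge0.
move=> delta k z d01 k0 k1 kj kz; have /andP[d0 d1] := d01.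
have [z0 zk] := kz.
have n0 : (0 : R) < i.+2%:R by rewrite ltr0n.
(* The term of k 1 = 1 is the Gaussian recursion [Hg2]; the higher cumulants form the
   perturbation. *)
have E : i.+2%:R * z i.+2 = z i + \sum_(j < i) k j.+2 * z (i.-1 - j)%N.
  rewrite zk !big_ord_recl/= k0 mul0r add0r k1 mul1r subn1 /=; congr (_ + _).
  apply: eq_bigr => j _; rewrite /bump/= !add1n; congr (_ * z _).
  by have := ltn_ord j; lia.
have SS : \sum_(j < i) c j.+2 <= S.
  by rewrite /S !big_ord_recl/= addrA ler_wpDl ?addr_ge0.
have n1 : (1 : R) <= i.+2%:R by rewrite ler1n.
have dle j : (0 < j)%N -> delta ^+ j <= delta.
  by case: j => // j _; rewrite exprS ler_piMr// exprn_ile1.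
have bnd e : (forall j : 'I_i, `|k j.+2 * z (i.-1 - j)%N| <= c j.+2 * (C * e)) ->
     0 <= e -> `|\sum_(j < i) k j.+2 * z (i.-1 - j)%N| <= S * C * e.
  move=> H e0; apply: le_trans (ler_norm_sum _ _ _) _.
  apply: (@le_trans _ _ (\sum_(j < i) c j.+2 * (C * e))).
    by apply: ler_sum => j _; exact: H.
  by rewrite -mulr_suml -mulrA ler_wpM2r// mulr_ge0.
have lei (j : 'I_i) : (i.-1 - j < i.+2)%N by have := ltn_ord j; lia.
have ndrop (x e : R) : 0 <= e -> `|i.+2%:R * x| <= (C + S * C) * e ->
    `|x| <= (C + S * C) * e.
  move=> e0; rewrite normrM normr_nat => H; apply: le_trans H.
  by rewrite ler_peMl.
have [Hi1 Hi2] := HC i (ltnW (ltnSn i.+1)) _ _ _ d01 k0 k1 kj kz.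
have kz1 (j : 'I_i) : `|k j.+2 * z (i.-1 - j)%N| <= c j.+2 * (C * delta).
  have [Hj _] := HC _ (lei j) _ _ _ d01 k0 k1 kj kz.
  rewrite normrM; apply: le_trans (ler_pM _ _ (kj j.+2 isT) Hj) _ => //.
  by rewrite -mulrA ler_wpM2l// mulrC ler_wpM2l// dle.
split.
  rewrite -[leRHS]mulr1; apply: ndrop => //; rewrite mulr1 E.
  apply: le_trans (ler_normD _ _) _; apply: lerD => //.
  rewrite -[leRHS]mulr1; apply: bnd => // j; apply: le_trans (kz1 j) _.
  by rewrite ler_wpM2l// ler_wpM2l.
rewrite /= negbK; case: ifP Hi2 => oi Hi2.
  apply: ndrop => //; rewrite E mulrDl; apply: le_trans (ler_normD _ _) _.
  by apply: lerD => //; exact: bnd.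
apply: ndrop; first exact: sqr_ge0.
rewrite mulrBr E Hg2 addrAC mulrDl; apply: le_trans (ler_normD _ _) _.
apply: lerD => //; apply: bnd; last exact: sqr_ge0.
move=> j; rewrite normrM.
have [Hj Hj2] := HC _ (lei j) _ _ _ d01 k0 k1 kj kz.
(* At j = 0 stands the skewness, with a single factor [delta]; as [i] is even, its partner [z i.-1]
   has odd index and supplies the second one. For j > 0 the cumulant alone is O(delta^2). *)
have [j0|j0] := posnP j.
  move: Hj2; rewrite j0 subn0; case: ifP => [_|]; last first.
    have i0 : (0 < i)%N by exact: leq_ltn_trans (ltn_ord j).
    have : odd i = ~~ odd i.-1 by rewrite -[in LHS](prednK i0).
    by rewrite oi => /esym/negbFE ->.
  move=> Hj2; apply: le_trans (ler_pM _ _ (kj 2%N isT) Hj2) _ => //.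
  by rewrite expr1 -mulrA [delta * _]mulrCA expr2.
apply: le_trans (ler_pM _ _ (kj j.+2 isT) Hj) _ => //.
rewrite -mulrA ler_wpM2l// mulrC ler_wpM2l//=.
exact: ler_wiXn2l.
Qed.

(** Along m, m + 2, m + 4, ... the values stay below f m, so a negative f m would contradict the
    limit 0. The step is 2 because the chi-square recursion links m to m + 2. *)
Lemma step2_ge0 (R : realType) (f : nat -> R) :
  f n @[n --> \oo] --> (0 : R) ->
  (forall m, (0 < m)%N -> f m.+2 <= f m) -> forall m, (0 < m)%N -> 0 <= f m.
Proof.
move=> f0 fd m m0.
have H l : f (l.*2 + m)%N <= f m.
  elim: l => // l IH; rewrite doubleS !addSn.
  by apply: le_trans (fd _ _) IH; rewrite addn_gt0 m0 orbT.
rewrite leNgt; apply/negP => fm.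
have /cvgrPdist_lt/(_ (- f m)) := f0; rewrite oppr_gt0 => /(_ fm)[N _ HN].
have /HN : (N <= N.*2 + m)%N by lia.
rewrite /= sub0r normrN => h.
have := H N; have := ler_norm (- f (N.*2 + m)%N); rewrite normrN; lra.
Qed.

(** * Gaussian families *)

Section gaussian_family.
Context {R : realType} {I : finType}.

Definition boxes : set (set (I -> R)) :=
  [set S | exists2 B : I -> set R, (forall i, measurable (B i)) &
    S = [set x | forall i, B i (x i)]].

(** A copy of [I -> R] that carries the product sigma-algebra, generated by the boxes. *)
Definition cyl := (I -> R).
HB.instance Definition _ := Pointed.on cyl.
HB.instance Definition _ := @isMeasurable.Build (sigma_display boxes) cyl
  <<s boxes >> (@sigma_algebra0 _ setT boxes) (@sigma_algebraC _ boxes)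
  (@sigma_algebra_bigcup _ setT boxes).

(** Independence and normality in one condition on full boxes; factors [setT] have probability 1, so
    subfamilies are covered too. *)
Definition gaussian_family (d : measure_display) (T : measurableType d)
    (P : probability T R) (X : I -> T -> R) : Prop :=
  (forall i, measurable_fun setT (X i)) /\
  forall B : I -> set R, (forall i, measurable (B i)) ->
    P [set w | forall i, B i (X i w)] = (\prod_i normal_prob 0 1 (B i))%E.

Lemma measurable_coord (i : I) : measurable_fun setT (fun x : cyl => x i).
Proof.
move=> _ B mB; rewrite setTI; apply: sub_sigma_algebra.
exists (fun j => if j == i then B else setT) => [j|]; first by case: ifP.
apply/seteqP; split => x /=; first by move=> Bx j; case: eqP => // ->.
by move=> /(_ i); rewrite eqxx.
Qed.

Lemma boxes_setI : setI_closed boxes.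
Proof.
move=> _ _ [B mB ->] [C mC ->]; exists (fun i => B i `&` C i).
  by move=> i; exact: measurableI.
apply/seteqP; split => x /=; first by move=> [H1 H2] i; split.
by move=> H; split=> i; case: (H i).
Qed.

Lemma measurable_into_cyl (d : measure_display) (T : measurableType d)
    (X : I -> T -> R) : (forall i, measurable_fun setT (X i)) ->
  measurable_fun setT (fun w => (fun i => X i w) : cyl).
Proof.
move=> mX; apply: (@measurability _ _ T cyl setT _ boxes) => //.
move=> _ [_ [B mB ->] <-]; rewrite setTI.
have -> : (fun w i => X i w) @^-1` [set x | forall i, B i (x i)] =
    \bigcap_(i in [set: I]) (X i @^-1` B i).
  by apply/seteqP; split => w /= H i; [move=> _; exact: H|exact: H].
apply: fin_bigcap_measurable => // i _.
by rewrite -[X in measurable X]setTI; exact: mX.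
Qed.

Lemma boxesT : boxes setT.
Proof. by exists (fun=> setT) => //; apply/seteqP; split. Qed.

Section law.
Context d d' (T : measurableType d) (T' : measurableType d')
  (P : probability T R) (P' : probability T' R) (X : I -> T -> R)
  (X' : I -> T' -> R).
Hypotheses (gX : gaussian_family P X) (gX' : gaussian_family P' X').

Let vec (w : T) : cyl := fun i => X i w.
Let vec' (w : T') : cyl := fun i => X' i w.
Let mvec : measurable_fun setT vec.
Proof. by apply: measurable_into_cyl; case: gX. Qed.
Let mvec' : measurable_fun setT vec'.
Proof. by apply: measurable_into_cyl; case: gX'. Qed.
HB.instance Definition _ := isMeasurableFun.Build _ _ _ _ vec mvec.
HB.instance Definition _ := isMeasurableFun.Build _ _ _ _ vec' mvec'.

(** Boxes form a pi-system and so determine a finite measure. A statement about one Gaussian family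
    can therefore be proved on a more convenient space, such as a product. *)
Lemma gaussian_law (S : set cyl) : measurable S ->
  pushforward P vec S = pushforward P' vec' S.
Proof.
move=> mS.
apply: (@measure_unique _ R cyl boxes (fun=> setT) _ _ _ _ 
   (pushforward P vec) (pushforward P' vec')) => //.
- exact: boxes_setI.
- by move=> _; exact: boxesT.
- by rewrite bigcup_const//; exists 0%N.
- move=> _ [B mB ->]; have [_ H] := gX; have [_ H'] := gX'.
  by rewrite /pushforward; exact: etrans (H _ mB) (esym (H' _ mB)).
- move=> _; apply: (@le_lt_trans _ _ (P setT)); first exact: lexx.
  by rewrite probability_setT ltry.
Qed.

Lemma ge0_gaussian_law (F : cyl -> \bar R) : measurable_fun setT F ->
  (forall x, 0 <= F x)%E ->
  (\int[P]_w F (fun i => X i w) = \int[P']_w F (fun i => X' i w))%E.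
Proof.
move=> mF F0.
rewrite -[LHS](ge0_integral_pushforward mvec P measurableT mF)//.
rewrite -[RHS](ge0_integral_pushforward mvec' P' measurableT mF)//.
by apply: eq_measure_integral => S mS _; exact: gaussian_law.
Qed.

Lemma integrable_gaussian_law (F : cyl -> \bar R) : measurable_fun setT F ->
  P'.-integrable setT (fun w => F (fun i => X' i w)) ->
  P.-integrable setT (fun w => F (fun i => X i w)) /\
  (\int[P]_w F (fun i => X i w) = \int[P']_w F (fun i => X' i w))%E.
Proof.
move=> mF iF'.
have iF : P.-integrable setT (fun w => F (fun i => X i w)).
  apply/integrableP; split.
    by apply: (measurableT_comp mF); exact: mvec.
  have/integrableP[_] := iF'.
  rewrite (@ge0_gaussian_law (fun x => `|F x|%E))//.
  exact: measurableT_comp.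
split => //.
rewrite -[LHS](@integral_pushforward _ _ _ _ R vec mvec P setT F)//.
rewrite -[RHS](@integral_pushforward _ _ _ _ R vec' mvec' P' setT F)//.
by apply: eq_measure_integral => S mS _; exact: gaussian_law.
Qed.

End law.

Section decouple.
Context d (T : measurableType d) (P : probability T R) (X : I -> T -> R).
Hypothesis gX : gaussian_family P X.
Variable J : pred I.

Let X2 (i : I) (w : T * T) : R := if J i then X i w.1 else X i w.2.

(** Drawing the coordinates outside [J] from an independent second copy leaves the law unchanged, so
    conditioning on the coordinates in [J] becomes an iterated integral. *)
Lemma gaussian_family_product : gaussian_family (P \x P)%E X2.
Proof.
have [mX HX] := gX; split=> [i|B mB].
  by rewrite /X2; case: (J i); apply: measurableT_comp => //; exact: mX.
pose B1 i := if J i then B i else setT.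
pose B2 i := if J i then setT else B i.
have mB1 i : measurable (B1 i) by rewrite /B1; case: ifP.
have mB2 i : measurable (B2 i) by rewrite /B2; case: ifP.
have -> : [set w | forall i, B i (X2 i w)] =
   [set w | forall i, B1 i (X i w)] `*` [set w | forall i, B2 i (X i w)].
  apply/seteqP; split => -[w1 w2] /=; rewrite /X2 /B1 /B2.
    by move=> H; split=> i; have := H i; case: ifP.
  by move=> [H1 H2] i; have := H1 i; have := H2 i; case: ifP.
have mbox C : (forall i, measurable (C i)) ->
    measurable [set w | forall i, C i (X i w)].
  move=> mC.
  have mC' : measurable ([set x | forall i, C i (x i)] : set cyl).
    by apply: sub_sigma_algebra; exists C.
  have := measurable_into_cyl mX measurableT mC'.
  by rewrite setTI.
apply: etrans (product_measure1E P P (mbox _ mB1) (mbox _ mB2)) _.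
apply: etrans (congr2 mule (HX _ mB1) (HX _ mB2)) _.
rewrite -big_split; apply: eq_bigr => i _ /=.
by rewrite /B1 /B2; case: ifP => _; rewrite probability_setT ?mule1 ?mul1e.
Qed.

Variable F : cyl -> \bar R.
Hypothesis mF : measurable_fun setT F.

Let mF2 : measurable_fun setT (fun w : T * T => F (fun i => X2 i w)).
Proof.
apply: (measurableT_comp mF); apply: measurable_into_cyl.
by case: gaussian_family_product.
Qed.

Lemma ge0_gaussian_decouple : (forall x, 0 <= F x)%E ->
  (\int[P]_w F (fun i => X i w) =
   \int[P]_w1 \int[P]_w2 F (fun i => if J i then X i w1 else X i w2))%E.
Proof.
move=> F0; rewrite (ge0_gaussian_law gX gaussian_family_product)//.
by rewrite fubini_tonelli1.
Qed.

Lemma gaussian_decouple :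
  (\int[P]_w1 \int[P]_w2 `|F (fun i => if J i then X i w1 else X i w2)| < +oo)%E ->
  P.-integrable setT (fun w => F (fun i => X i w)) /\
  (\int[P]_w F (fun i => X i w) =
   \int[P]_w1 \int[P]_w2 F (fun i => if J i then X i w1 else X i w2))%E.
Proof.
move=> Foo.
have i2 : (P \x P)%E.-integrable setT (fun w : T * T => F (fun i => X2 i w)).
  by apply/integrable12ltyP.
have [iF ->] := integrable_gaussian_law gX gaussian_family_product mF i2.
by split => //; rewrite -integral12_prod_meas1.
Qed.

End decouple.
End gaussian_family.

(** * Rotation invariance of the normal law *)

Section affine_substitution.
Context {R : realType}.

Let GR := measurableTypeR R.

Let measurable_idGR : measurable_fun setT (idfun : GR -> R).
Proof. by move=> _ A mA; rewrite setTI. Qed.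

(* [lebesgue_measure] lives on [measurableTypeR R], whose display differs from
   the one of the canonical measurable structure of [R]; products with other
   measures are formed with this copy. *)
Definition leb : set R -> \bar R := @lebesgue_measure R.

HB.instance Definition _ := isMeasure.Build _ _ _ leb
  (@measure0 _ _ _ (@lebesgue_measure R))
  (@measure_ge0 _ _ _ (@lebesgue_measure R))
  (@measure_semi_sigma_additive _ _ _ (@lebesgue_measure R)).

Let leb_sigma_finite : sigma_finite setT leb.
Proof. exact: (@sigma_finiteT _ _ _ (@lebesgue_measure R)). Qed.

HB.instance Definition _ := Measure_isSigmaFinite.Build _ _ _ leb
  leb_sigma_finite.

Lemma ge0_integral_leb (f : R -> \bar R) : measurable_fun setT f ->
  (forall x, 0 <= f x)%E ->
  (\int[leb]_x f x = \int[@lebesgue_measure R]_x f x)%E.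
Proof.
move=> mf f0.
exact: (ge0_integral_pushforward measurable_idGR (@lebesgue_measure R)).
Qed.

(** The pushforward under x -> a x + b, scaled by |a|, agrees with Lebesgue measure on half-open
    intervals; for a < 0 the open end of the preimage changes sides. *)
Lemma lebesgue_measure_affine (a b : R) (A : set GR) : a != 0 -> measurable A ->
  (@lebesgue_measure R A =
   `|a|%:E * @lebesgue_measure R ((fun x => (a * x + b)%R) @^-1` A))%E.
Proof.
move=> a0 mA.
have maff : measurable_fun setT (fun x : GR => a * x + b : GR).
  have : measurable_fun setT (fun x : R => a * x + b).
    by apply: measurable_funD => //; exact: measurable_funM.
  by [].
have na0 : 0 <= `|a| by [].
pose m : {measure set GR -> \bar R} := mscale (NngNum na0)
  (measure_function_pushforward__canonical__measure_function_Measure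
    (@lebesgue_measure R) maff).
suff : @lebesgue_measure R A = m A by [].
apply: lebesgue_measure_unique => // _ [[u v]] _ <-.
rewrite /m /= /mscale /= /pushforward /=.
have H : (fun x => a * x + b) @^-1` `]u, v] =
    if 0 < a then `](u - b) / a, (v - b) / a]%classic
    else `[(v - b) / a, (u - b) / a[%classic.
  case: ltP => sa; apply/seteqP; split => x /=; rewrite !in_itv /=.
  - by rewrite ltr_pdivrMr// ler_pdivlMr// ltrBlDr lerBrDr mulrC.
  - by rewrite ltr_pdivrMr// ler_pdivlMr// ltrBlDr lerBrDr mulrC.
  - have na : a < 0 by rewrite lt_neqAle a0.
    by rewrite ltr_ndivlMr// ler_ndivrMr// ltrBlDr lerBrDr mulrC andbC.
  - have na : a < 0 by rewrite lt_neqAle a0.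
    by rewrite ltr_ndivlMr// ler_ndivrMr// ltrBlDr lerBrDr mulrC andbC.
rewrite H; case: ltP => sa.
  rewrite !lebesgue_measure_itv/= !lte_fin ltr_pM2r ?invr_gt0// ltrD2r.
  case: ifP => // _; last by rewrite mule0.
  rewrite -!EFinB -EFinM; congr EFin.
  by rewrite gtr0_norm//; field; rewrite gt_eqF.
have na : a < 0 by rewrite lt_neqAle a0.
rewrite !lebesgue_measure_itv/= !lte_fin ltr_nM2r ?invr_lt0// ltrD2r.
case: ifP => // _; last by rewrite mule0.
rewrite -!EFinB -EFinM; congr EFin.
by rewrite ltr0_norm//; field; rewrite lt_eqF.
Qed.

Lemma ge0_integral_affine (a b : R) (f : R -> \bar R) : a != 0 ->
  measurable_fun setT f -> (forall x, 0 <= f x)%E ->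
  (\int[leb]_x f (a * x + b)%R = `|a|^-1%:E * \int[leb]_x f x)%E.
Proof.
move=> a0 mf f0.
have maff : measurable_fun setT (fun x : R => a * x + b : R).
  by apply: measurable_funD => //; exact: measurable_funM.
have na0 : 0 <= `|a| by [].
pose m : {measure set R -> \bar R} := mscale (NngNum na0)
  (measure_function_pushforward__canonical__measure_function_Measure leb maff).
rewrite [X in (_ * X)%E](eq_measure_integral m) => [|A mA _].
  rewrite /m ge0_integral_mscale//= muleA -EFinM mulVf ?normr_eq0// mul1e.
  by rewrite (ge0_integral_pushforward maff).
exact: lebesgue_measure_affine.
Qed.

Local Notation mu := leb.

(** For c != 0 a rotation factors into two affine substitutions in one variable: u = c x + s y at
    fixed y, then v = y / c - (s / c) u at fixed u. The factors |c|^-1 and |c| cancel. *)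
Lemma lebesgue_rotation (c s : R) (H : R * R -> \bar R) :
  c ^+ 2 + s ^+ 2 = 1 -> c != 0 -> measurable_fun setT H ->
  (forall z, 0 <= H z)%E ->
  (\int[mu]_x \int[mu]_y H ((c * x + s * y)%R, (- s * x + c * y)%R) =
   \int[mu]_x \int[mu]_y H (x, y))%E.
Proof.
move=> cs1 c0 mH H0.
have mlin (a b : R) : measurable_fun setT (fun z : R * R => a * z.1 + b * z.2).
  by apply: measurable_funD; apply: measurable_funM.
pose H1 (z : R * R) := H (c * z.1 + s * z.2, - s * z.1 + c * z.2).
have mH1 : measurable_fun setT H1.
  by apply: measurableT_comp => //; apply: measurable_fun_pair; exact: mlin.
pose H2 (z : R * R) := H (z.1, c^-1 * z.2 + (- s / c) * z.1).
have mH2 : measurable_fun setT H2.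
  apply: measurableT_comp => //; apply: measurable_fun_pair => //.
  under eq_fun do rewrite addrC.
  exact: mlin.
have H10 z : (0 <= H1 z)%E by exact: H0.
have H20 z : (0 <= H2 z)%E by exact: H0.
apply: etrans (@fubini_tonelli _ _ _ _ _ mu mu H1 mH1 H10) _.
transitivity (\int[mu]_y (`|c|^-1%:E * \int[mu]_u H2 (u, y)))%E.
  apply: eq_integral => y _.
  rewrite -(@ge0_integral_affine c (s * y) (fun u => H2 (u, y))); last 3 first.
  - exact: c0.
  - exact: (measurableT_comp mH2).
  - by move=> x; exact: H20.
  apply: eq_integral => x _; rewrite /H1 /H2 /=; congr (H (_, _)).
  have -> : c^-1 * y = c^-1 * ((c ^+ 2 + s ^+ 2) * y) by rewrite cs1 mul1r.
  by field.
rewrite ge0_integralZl//; last 2 first.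
- exact: (@measurable_fun_fubini_tonelli_G _ _ _ _ _ mu H2).
- by move=> y _; exact: integral_ge0.
rewrite -(@fubini_tonelli _ _ _ _ _ mu mu H2 mH2 H20).
rewrite -ge0_integralZl//; last 2 first.
- exact: (@measurable_fun_fubini_tonelli_F _ _ _ _ _ mu H2).
- by move=> y _; exact: integral_ge0.
apply: eq_integral => x _.
rewrite (@ge0_integral_affine c^-1 (- s / c * x) (fun v => H (x, v)))//.
- by rewrite muleA -EFinM normfV invrK mulVf ?normr_eq0// mul1e.
- by rewrite invr_eq0.
- exact: (measurableT_comp mH).
Qed.

End affine_substitution.

Section normal_law.
Context {R : realType}.
Local Notation mu := (@leb R).
Local Notation phi := (@normal_pdf R 0 1).
Local Notation N01 := (@normal_prob R 0 1).

Lemma normal_pdf01E x : phi x = normal_peak 1 * expR (- (x ^+ 2 / 2)).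
Proof.
by rewrite normal_pdfE ?oner_neq0// /normal_fun subr0 expr1n mulNr.
Qed.

(** The Radon-Nikodym derivative and [phi] have the same integral over every measurable set, hence
    agree almost everywhere. *)
Lemma ge0_integral_normal (f : R -> \bar R) : measurable_fun setT f ->
  (forall x, 0 <= f x)%E ->
  (\int[N01]_x f x = \int[mu]_x (f x * (phi x)%:E))%E.
Proof.
move=> mf f0.
have mphi : measurable_fun setT (fun x => (phi x)%:E).
  by apply/measurable_EFinP; exact: measurable_normal_pdf.
rewrite ge0_integral_leb//; last 2 first.
- exact: emeasurable_funM.
- by move=> x; rewrite mule_ge0// lee_fin normal_pdf_ge0.
have dom := normal_prob_dominates 0 1 : N01 `<< @lebesgue_measure R.
rewrite -(Radon_Nikodym_SigmaFinite.change_of_variables dom)//.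
have iRN := Radon_Nikodym_SigmaFinite.f_integrable dom.
apply: ge0_ae_eq_integral => //.
- by apply: emeasurable_funM => //; exact: measurable_int iRN.
- exact: emeasurable_funM.
- by move=> x _; rewrite mule_ge0// Radon_Nikodym_SigmaFinite.f_ge0.
- by move=> x _; rewrite mule_ge0// lee_fin normal_pdf_ge0.
- apply: ae_eqe_mul2l; apply: integral_ae_eq => // E _ mE.
  by rewrite -Radon_Nikodym_SigmaFinite.f_integral.
Qed.

(** The joint density depends on x^2 + y^2 only, which reduces the claim to [lebesgue_rotation]. *)
Lemma normal_rotation (c s : R) (H : R * R -> \bar R) :
  c ^+ 2 + s ^+ 2 = 1 -> c != 0 -> measurable_fun setT H ->
  (forall z, 0 <= H z)%E ->
  (\int[N01]_x \int[N01]_y H ((c * x + s * y)%R, (- s * x + c * y)%R) =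
   \int[N01]_x \int[N01]_y H (x, y))%E.
Proof.
move=> cs1 c0 mH H0.
have mphi : measurable_fun setT (fun x => (phi x)%:E).
  by apply/measurable_EFinP; exact: measurable_normal_pdf.
have phi0 x : (0 <= (phi x)%:E)%E by rewrite lee_fin normal_pdf_ge0.
have E (K : R * R -> \bar R) : measurable_fun setT K -> (forall z, 0 <= K z)%E ->
   (\int[N01]_x \int[N01]_y K (x, y) =
    \int[mu]_x \int[mu]_y (K (x, y) * ((phi x)%:E * (phi y)%:E)))%E.
  move=> mK K0.
  rewrite ge0_integral_normal//; last 2 first.
  - exact: (@measurable_fun_fubini_tonelli_F _ _ _ _ _ N01).
  - by move=> x; exact: integral_ge0.
  apply: eq_integral => /= x _.
  have mKx : measurable_fun setT (fun y => K (x, y)) by exact: (measurableT_comp mK).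
  rewrite ge0_integral_normal// -ge0_integralZr//.
  - by apply: eq_integral => y _; rewrite -muleA [X in (_ * X)%E]muleC.
  - exact: emeasurable_funM.
  - by move=> y _; rewrite mule_ge0.
have mlin (a b : R) : measurable_fun setT (fun z : R * R => a * z.1 + b * z.2).
  by apply: measurable_funD; apply: measurable_funM.
pose H1 (z : R * R) := H (c * z.1 + s * z.2, - s * z.1 + c * z.2).
have mH1 : measurable_fun setT H1.
  by apply: measurableT_comp => //; apply: measurable_fun_pair; exact: mlin.
have H10 z : (0 <= H1 z)%E by exact: H0.
apply: etrans (E H1 mH1 H10) _; rewrite (E H mH H0).
pose G (z : R * R) := (H z * ((phi z.1)%:E * (phi z.2)%:E))%E.
have mG : measurable_fun setT G.
  apply: emeasurable_funM => //; apply: emeasurable_funM.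
    exact: (measurableT_comp mphi).
  exact: (measurableT_comp mphi).
have G0 z : (0 <= G z)%E by rewrite !mule_ge0.
apply: etrans (lebesgue_rotation cs1 c0 mG G0).
apply: eq_integral => x _; apply: eq_integral => y _.
rewrite /H1 /G /=; congr (_ * _)%E; rewrite -!EFinM; congr EFin.
rewrite !normal_pdf01E [LHS]mulrACA [RHS]mulrACA -!expRD; congr (_ * expR _).
rewrite -!opprD -!mulrDl; congr (- (_ / _)).
have -> : (c * x + s * y) ^+ 2 + (- s * x + c * y) ^+ 2 =
   (c ^+ 2 + s ^+ 2) * (x ^+ 2 + y ^+ 2) by ring.
by rewrite cs1 mul1r.
Qed.

End normal_law.

Lemma normal_rotation_rectangle {R : realType} (c s : R) (U V : set R) :
  c ^+ 2 + s ^+ 2 = 1 -> c != 0 -> measurable U -> measurable V ->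
  ((@normal_prob R 0 1 \x @normal_prob R 0 1)
     [set z | U (c * z.1 + s * z.2)%R /\ V (- s * z.1 + c * z.2)%R] =
   normal_prob 0 1 U * normal_prob 0 1 V)%E.
Proof.
move=> cs1 c0 mU mV; pose N01 := @normal_prob R 0 1.
have mlin (u v : R) : measurable_fun setT (fun z : R * R => u * z.1 + v * z.2).
  by apply: measurable_funD; apply: measurable_funM.
have mrot : measurable_fun setT
    (fun z : R * R => (c * z.1 + s * z.2, - s * z.1 + c * z.2)).
  by apply: measurable_fun_pair; exact: mlin.
have mUV : measurable (U `*` V) by exact: measurableX.
have mind (S : set (R * R)) : measurable S ->
    ((N01 \x N01) S = \int[N01]_x \int[N01]_y (\1_S (x, y))%:E)%E.
  move=> mS; rewrite -[S in LHS]setIT -(integral_indic (N01 \x N01)%E measurableT mS).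
  rewrite fubini_tonelli1//.
  by apply/measurable_EFinP; exact: measurable_indic.
set S := [set z | _].
have ES : S = (fun z : R * R => (c * z.1 + s * z.2, - s * z.1 + c * z.2)) @^-1`
   (U `*` V) by apply/seteqP; split.
have mS : measurable S.
  by rewrite ES -[X in measurable X]setTI; exact: mrot.
rewrite (mind _ mS) -(product_measure1E N01 N01 mU mV) (mind _ mUV).
rewrite -(@normal_rotation _ c s (fun z => (\1_(U `*` V) z)%:E))//.
by apply/measurable_EFinP; exact: measurable_indic.
Qed.

Section gaussian_rotation.
Context {R : realType} {I : finType} (d : measure_display)
  (T : measurableType d) (P : probability T R) (X : I -> T -> R).
Hypothesis gX : gaussian_family P X.
Variables (a b : I) (c s : R).
Hypotheses (ab : a != b) (cs1 : c ^+ 2 + s ^+ 2 = 1) (c0 : c != 0).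

Definition rotate_pair (i : I) (w : T) : R :=
  if i == a then c * X a w + s * X b w
  else if i == b then - s * X a w + c * X b w else X i w.

Local Notation N01 := (@normal_prob R 0 1).

(* By [gaussian_law], [X a] and [X b] may be replaced by the coordinates of an
   independent normal pair. *)
Lemma gaussian_family_rotate_pair : gaussian_family P rotate_pair.
Proof.
have [mX HX] := gX.
have ba : b != a by rewrite eq_sym.
have mlin (u v : R) : measurable_fun setT (fun z : R * R => u * z.1 + v * z.2).
  by apply: measurable_funD; apply: measurable_funM.
have mrot i : measurable_fun setT (rotate_pair i).
  have mab : measurable_fun setT (fun w => (X a w, X b w) : R * R).
    exact: measurable_fun_pair.
  rewrite /rotate_pair; case: (i == a).
    exact: (measurableT_comp (mlin c s) mab).
  case: (i == b); last exact: mX.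
  exact: (measurableT_comp (mlin (- s) c) mab).
pose others (B : I -> set R) := [set w | forall i, i != a -> i != b -> B i (X i w)].
pose Bo (B : I -> set R) i := if (i == a) || (i == b) then setT else B i.
have othersE (B : I -> set R) : others B = [set w | forall i, Bo B i (X i w)].
  apply/seteqP; split => w /= H i.
    by rewrite /Bo; case: eqP => [//|/eqP ia]; case: eqP => [//|/eqP ib]; exact: H.
  by move=> ia ib; have := H i; rewrite /Bo (negbTE ia) (negbTE ib).
have mBo (B : I -> set R) : (forall i, measurable (B i)) ->
    forall i, measurable (Bo B i).
  by move=> mB i; rewrite /Bo; case: ifP.
have mothers (B : I -> set R) : (forall i, measurable (B i)) -> measurable (others B).
  move=> mB; rewrite othersE.
  have mC : measurable ([set x | forall i, Bo B i (x i)] : set (@cyl R I)).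
    by apply: sub_sigma_algebra; exists (Bo B) => //; exact: mBo.
  by have := measurable_into_cyl mX measurableT mC; rewrite setTI.
have Pothers (B : I -> set R) : (forall i, measurable (B i)) ->
    (N01 (B a) * N01 (B b) * P (others B) = \prod_i N01 (B i))%E.
  move=> mB; rewrite othersE (HX _ (mBo _ mB)).
  rewrite [RHS](bigD1 a)//= [in RHS](bigD1 b)//= muleA; congr (_ * _)%E.
  rewrite (bigD1 a)//= (bigD1 b)//= /Bo !eqxx /= orbT !probability_setT !mul1e.
  by apply: eq_bigr => i /andP[/negbTE -> /negbTE ->].
pose Q := ((N01 \x N01) \x P)%E.
pose Y (i : I) (z : R * R * T) : R :=
  if i == a then z.1.1 else if i == b then z.1.2 else X i z.2.
have gY : gaussian_family Q Y.
  split=> [i|B mB].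
    rewrite /Y; case: (i == a); first exact: measurableT_comp.
    by case: (i == b); [exact: measurableT_comp|exact: (measurableT_comp (mX i))].
  have -> : [set z | forall i, B i (Y i z)] = (B a `*` B b) `*` others B.
    apply/seteqP; split => -[[x y] w] /=.
      move=> H; split; first split.
      - by have := H a; rewrite /Y eqxx.
      - by have := H b; rewrite /Y eqxx (negbTE ba).
      - by move=> i ia ib; have := H i; rewrite /Y (negbTE ia) (negbTE ib).
    move=> [[/= Ha Hb] H] i; rewrite /Y.
    by case: eqP => [->//|/eqP ia]; case: eqP => [->//|/eqP ib]; exact: H.
  apply: etrans (product_measure1E (N01 \x N01)%E P (measurableX (mB a) (mB b)) (mothers _ mB)) _.
  apply: etrans _ (Pothers _ mB).
  exact: (congr1 (fun x => x * P (others B))%E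
    (product_measure1E N01 N01 (mB a) (mB b))).
split=> // B mB.
pose rot (x : @cyl R I) (i : I) : R := if i == a then c * x a + s * x b
  else if i == b then - s * x a + c * x b else x i.
(* The preimage of a box under the rotation is not a box, so equality of the laws on all measurable
   sets is needed here. *)
pose S : set (@cyl R I) := [set x | forall i, B i (rot x i)].
have mS : measurable S.
  have mr : measurable_fun setT (fun x : @cyl R I => (rot x : @cyl R I)).
    apply: measurable_into_cyl => i.
    have mab : measurable_fun setT (fun x : @cyl R I => (x a, x b) : R * R).
      by apply: measurable_fun_pair; exact: measurable_coord.
    rewrite /rot; case: (i == a).
      exact: (measurableT_comp (mlin c s) mab).
    case: (i == b); last exact: measurable_coord.
    exact: (measurableT_comp (mlin (- s) c) mab).
  have mC : measurable ([set x | forall i, B i (x i)] : set (@cyl R I)).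
    by apply: sub_sigma_algebra; exists B.
  by have := mr measurableT _ mC; rewrite setTI.
have := gaussian_law gX gY mS.
rewrite /pushforward => E; apply: etrans (etrans E _).
  by congr (P _); apply/seteqP; split.
pose D := [set z : R * R | B a (c * z.1 + s * z.2) /\ B b (- s * z.1 + c * z.2)].
have mD : measurable D.
  have -> : D = (fun z : R * R => (c * z.1 + s * z.2, - s * z.1 + c * z.2)) @^-1`
   (B a `*` B b) by apply/seteqP; split.
  rewrite -[X in measurable X]setTI.
  have : measurable_fun setT
    (fun z : R * R => (c * z.1 + s * z.2, - s * z.1 + c * z.2)).
    by apply: measurable_fun_pair; exact: mlin.
  by apply => //; exact: measurableX.
have -> : (fun w i => Y i w) @^-1` S = D `*` others B.
  apply/seteqP; split => -[[x y] w] /=; rewrite /S /rot /Y /D /= !eqxx (negbTE ba).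
    move=> H; split; first split.
    - by have := H a; rewrite eqxx.
    - by have := H b; rewrite eqxx (negbTE ba).
    - by move=> i ia ib; have := H i; rewrite (negbTE ia) (negbTE ib).
  move=> [[/= Ha Hb] H] i.
  by case: eqP => [->//|/eqP ia]; case: eqP => [->//|/eqP ib]; exact: H.
apply: etrans (product_measure1E (N01 \x N01)%E P mD (mothers _ mB)) _.
apply: etrans _ (Pothers _ mB).
exact: (congr1 (fun x => x * P (others B))%E
  (normal_rotation_rectangle cs1 c0 (mB a) (mB b))).
Qed.

End gaussian_rotation.

Section subfamily.
Context {R : realType} {I J : finType} (d : measure_display)
  (T : measurableType d) (P : probability T R) (X : I -> T -> R).
Hypothesis gX : gaussian_family P X.

Lemma gaussian_family_sub (h : J -> I) : injective h ->
  gaussian_family P (fun j => X (h j)).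
Proof.
move=> hinj; have [mX HX] := gX; split=> // B mB.
(* Coordinates outside the image of [h] are left free. *)
pose B' i := if [pick j | h j == i] is Some j then B j else setT.
have B'h j : B' (h j) = B j.
  rewrite /B'; case: pickP => [k /eqP/hinj->//|/(_ j)].
  by rewrite eqxx.
have B'n i : i \notin codom h -> B' i = setT.
  move=> hi; rewrite /B'; case: pickP => // k /eqP hk.
  by move: hi; rewrite -hk codom_f.
have -> : [set w | forall j, B j (X (h j) w)] = [set w | forall i, B' i (X i w)].
  apply/seteqP; split => w /= H i; last by rewrite -B'h.
  have [/codomP[j ->]|/B'n ->//] := boolP (i \in codom h).
  by rewrite B'h.
rewrite HX; last by move=> i; rewrite /B'; case: pickP.
rewrite (bigID (fun i => i \in codom h))/= [X in (_ * X)%E]big1 ?mule1.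
  rewrite -big_uniq ?(map_inj_uniq hinj) ?enum_uniq//=.
  by rewrite /codom big_image; apply: eq_bigr => j _; rewrite B'h.
by move=> i /B'n ->; rewrite probability_setT.
Qed.

Lemma gaussian_coord (i : I) (B : set R) : measurable B ->
  P (X i @^-1` B) = normal_prob 0 1 B.
Proof.
move=> mB; have [mX HX] := gX.
pose B' j := if j == i then B else setT.
have -> : X i @^-1` B = [set w | forall j, B' j (X j w)].
  apply/seteqP; split => w /=; rewrite /B'; last by move=> /(_ i); rewrite eqxx.
  by move=> H j; case: eqP => // ->.
rewrite HX; last by move=> j; rewrite /B'; case: ifP.
rewrite (bigD1 i)//= big1 ?mule1; first by rewrite /B' eqxx.
by move=> j /negbTE ji; rewrite /B' ji probability_setT.
Qed.

Lemma ge0_integral_gaussian_coord (i : I) (f : R -> \bar R) :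
  measurable_fun setT f -> (forall x, 0 <= f x)%E ->
  (\int[P]_w f (X i w) = \int[leb]_x (f x * (normal_pdf 0 1 x)%:E))%E.
Proof.
move=> mf f0; have [mX HX] := gX; rewrite -ge0_integral_normal//.
rewrite -[LHS](ge0_integral_pushforward (mX i) P measurableT mf)//.
have mid : measurable_fun setT (idfun : measurableTypeR R -> R).
  by move=> _ S mS; rewrite setTI.
rewrite -[RHS](ge0_integral_pushforward mid (normal_prob 0 1) measurableT mf)//.
by apply: eq_measure_integral => S mS _; exact: gaussian_coord.
Qed.

End subfamily.

(** * The chi-square law *)

Section chi_square.
Context {R : realType}.
Local Notation mu := (@leb R).

(** Up to a constant, the density of a chi variable with n + 1 degrees of freedom and a random sign.
    On the whole line the case n = 0 is the normal density, and affine substitutions involve no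
    endpoints. *)
Definition chi_kernel (n : nat) (r : R) : R := `|r| ^+ n * expR (- (r ^+ 2 / 2)).

Lemma chi_kernel_ge0 n r : 0 <= chi_kernel n r.
Proof. by rewrite mulr_ge0 ?exprn_ge0 ?expR_ge0. Qed.

Lemma chi_kernelS n r : chi_kernel n.+1 r = `|r| * chi_kernel n r.
Proof. by rewrite /chi_kernel (exprS `|r|) mulrA. Qed.

Lemma measurable_chi_kernel n : measurable_fun setT (chi_kernel n).
Proof.
apply: measurable_funM.
  by apply: measurable_funX; exact: normr_measurable.
apply: measurableT_comp => //; apply: measurableT_comp => //.
by apply: measurable_funM => //; exact: measurable_funX.
Qed.

Let measurable_chi_kernelE n : measurable_fun setT (fun r => (chi_kernel n r)%:E).
Proof. by apply/measurable_EFinP; exact: measurable_chi_kernel. Qed.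

(** The constant is left open and may a priori be infinite: the induction on [n] produces it as a
    product of integrals that are never evaluated, and [chi_square_density] recovers it from the
    total mass. *)
Definition chi_square_law (n : nat) (c : \bar R) : Prop :=
  forall (d : measure_display) (T : measurableType d) (P : probability T R)
    (X : 'I_n.+1 -> T -> R), gaussian_family P X ->
  forall f : R -> \bar R, measurable_fun setT f -> (forall x, 0 <= f x)%E ->
  (\int[P]_w f (\sum_i X i w ^+ 2)%R =
   c * \int[mu]_r (f (r ^+ 2)%R * (chi_kernel n r)%:E))%E.

Lemma chi_square_law0 : chi_square_law 0 (normal_peak 1)%:E.
Proof.
move=> d T P X gX f mf f0.
have msq : measurable_fun setT (fun r : R => r ^+ 2) by exact: measurable_funX.
have mf2 : measurable_fun setT (fun r : R => f (r ^+ 2)).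
  exact: (measurableT_comp mf msq).
under eq_integral do rewrite big_ord1.
rewrite (ge0_integral_gaussian_coord gX ord0 mf2)//.
rewrite -ge0_integralZl//.
- apply: eq_integral => x _; rewrite normal_pdf01E /chi_kernel expr0 mul1r EFinM.
  by rewrite muleCA.
- exact: emeasurable_funM.
- by move=> x _; rewrite mule_ge0// lee_fin chi_kernel_ge0.
- by rewrite lee_fin normal_peak_ge0.
Qed.

(* Substituting [x = r * t] and then [r = s / sqrt (1 + t^2)] separates the
   integral over the plane. *)
Lemma chi_kernel_plane (n : nat) (f : R -> \bar R) :
  measurable_fun setT f -> (forall x, 0 <= f x)%E ->
  (\int[mu]_x \int[mu]_r (f (x ^+ 2 + r ^+ 2)%R * (chi_kernel 0 x * chi_kernel n r)%:E) =
   (\int[mu]_t ((Num.sqrt (1 + t ^+ 2))^-1 ^+ n.+2)%:E) *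
   \int[mu]_s (f (s ^+ 2)%R * (chi_kernel n.+1 s)%:E))%E.
Proof.
move=> mf f0.
have k0 m r : (0 <= (chi_kernel m r)%:E)%E by rewrite lee_fin chi_kernel_ge0.
have msq : measurable_fun setT (fun r : R => r ^+ 2) by exact: measurable_funX.
have mfst : measurable_fun setT (fun z : R * R => z.1) by exact: measurable_fst.
have msnd : measurable_fun setT (fun z : R * R => z.2) by exact: measurable_snd.
pose F (z : R * R) := (f (z.1 ^+ 2 + z.2 ^+ 2)%R * (chi_kernel 0 z.1 * chi_kernel n z.2)%:E)%E.
have mk m (g : R * R -> R) : measurable_fun setT g ->
    measurable_fun setT (fun z => (chi_kernel m (g z))%:E).
  by move=> mg; exact: (measurableT_comp (measurable_chi_kernelE m) mg).
have mF : measurable_fun setT F.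
  apply: emeasurable_funM.
    apply: (measurableT_comp mf); apply: measurable_funD.
      exact: (measurableT_comp msq mfst).
    exact: (measurableT_comp msq msnd).
  rewrite /=; under eq_fun do rewrite EFinM.
  by apply: emeasurable_funM; exact: mk.
have F0 z : (0 <= F z)%E by rewrite mule_ge0// EFinM mule_ge0.
rewrite (@fubini_tonelli _ _ _ _ _ mu mu F mF F0).
pose G (z : R * R) := (f (z.1 ^+ 2 * (1 + z.2 ^+ 2))%R *
  (chi_kernel 0 (z.1 * z.2) * chi_kernel n.+1 z.1)%:E)%E.
have mmul : measurable_fun setT (fun z : R * R => z.1 * z.2).
  exact: measurable_funM.
have mG : measurable_fun setT G.
  apply: emeasurable_funM.
    apply: (measurableT_comp mf); apply: measurable_funM.
      exact: (measurableT_comp msq mfst).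
    by apply: measurable_funD => //; exact: (measurableT_comp msq msnd).
  rewrite /=; under eq_fun do rewrite EFinM.
  by apply: emeasurable_funM; exact: mk.
have G0 z : (0 <= G z)%E by rewrite mule_ge0// EFinM mule_ge0.
transitivity (\int[mu]_r \int[mu]_t G (r, t))%E.
  apply: ge0_ae_eq_integral => //.
  - exact: (@measurable_fun_fubini_tonelli_G _ _ _ _ _ mu F).
  - exact: (@measurable_fun_fubini_tonelli_F _ _ _ _ _ mu G).
  - by move=> r _; exact: integral_ge0.
  - by move=> r _; exact: integral_ge0.
  (* The substitution x = r t degenerates only at r = 0, a null set. *)
  exists [set 0]; split => //; first exact: lebesgue_measure_set1.
  move=> r /=; apply: contra_notP => /eqP r0 _.
  have mFr : measurable_fun setT (fun x => F (x, r)).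
    exact: (measurableT_comp mF).
  have mGr : measurable_fun setT (fun t => G (r, t)).
    exact: (measurableT_comp mG).
  have := @ge0_integral_affine _ r 0 (fun x => F (x, r)) r0 mFr (fun x => F0 _).
  move=> /(congr1 (fun y => `|r|%:E * y)%E).
  rewrite muleA -EFinM divff ?normr_eq0// mul1e => <-.
  rewrite -ge0_integralZl//; last first.
    by apply: (measurableT_comp mFr); apply: measurable_funD.
  apply: eq_integral => t _; rewrite /F /G /= addr0.
  have -> : (r * t) ^+ 2 + r ^+ 2 = r ^+ 2 * (1 + t ^+ 2) by ring.
  rewrite muleCA -EFinM; congr (_ * _%:E)%E.
  by rewrite mulrCA chi_kernelS.
rewrite (@fubini_tonelli _ _ _ _ _ mu mu G mG G0).
pose u (t : R) := (Num.sqrt (1 + t ^+ 2))^-1.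
have s1 t : 0 < 1 + t ^+ 2 :> R by rewrite ltr_pwDl// sqr_ge0.
have u0 t : 0 < u t by rewrite invr_gt0 sqrtr_gt0.
have mu' : measurable_fun setT u.
  apply: measurable_funTS; apply: continuous_measurable_fun => t.
  apply: cvgV; first by rewrite gt_eqF// sqrtr_gt0.
  apply: (@continuous_comp _ _ _ (fun t : R => 1 + t ^+ 2) Num.sqrt);
    last exact: sqrt_continuous.
  by apply: cvgD; [exact: cvg_cst|exact: sqr_continuous].
pose I1 := (\int[mu]_s (f (s ^+ 2)%R * (chi_kernel n.+1 s)%:E))%E; rewrite -/I1.
have mk1 : measurable_fun setT (fun s : R => f (s ^+ 2)%R * (chi_kernel n.+1 s)%:E)%E.
  by apply: emeasurable_funM => //; exact: (measurableT_comp mf).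
have k1 s : (0 <= f (s ^+ 2)%R * (chi_kernel n.+1 s)%:E)%E by rewrite mule_ge0.
(* Of the exponent n + 2, the kernel contributes n + 1 and dr contributes one. *)
transitivity (\int[mu]_t ((u t ^+ n.+2)%:E * I1))%E; last first.
  rewrite ge0_integralZr//.
  - by apply/measurable_EFinP; exact: measurable_funX.
  - by move=> t _; rewrite lee_fin exprn_ge0// ltW.
  - by apply: integral_ge0.
have ui2' t : (u t)^-1 ^+ 2 = 1 + t ^+ 2 by rewrite /u invrK sqr_sqrtr// ltW.
clearbody u.
apply: eq_integral => t _; have ui2 := ui2' t.
have ui0 : (u t)^-1 != 0 by rewrite invr_eq0 gt_eqF.
pose K (s : R) := (f (s ^+ 2)%R * (chi_kernel n.+1 s)%:E)%E.
have := @ge0_integral_affine _ (u t)^-1 0 K ui0 mk1 k1.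
rewrite normfV invrK (gtr0_norm (u0 t)) -/I1.
move=> /(congr1 (fun y => (u t ^+ n.+1)%:E * y)%E).
rewrite muleA -EFinM -exprSr => <-.
have mK1 : measurable_fun setT (fun x : R => K ((u t)^-1 * x + 0)).
  by apply: (measurableT_comp mk1); apply: measurable_funD.
have ut0 : (0 <= (u t ^+ n.+1)%:E)%E by rewrite lee_fin exprn_ge0// ltW.
apply/esym; apply: etrans (esym (ge0_integralZl mu measurableT mK1 _ ut0)) _.
  by move=> x _; exact: k1.
apply/esym.
apply: eq_integral => r _; rewrite /G /K /= addr0.
have -> : ((u t)^-1 * r) ^+ 2 = r ^+ 2 * (1 + t ^+ 2) by rewrite exprMn ui2 mulrC.
rewrite muleCA -EFinM; congr (_ * _%:E)%E.
rewrite /chi_kernel expr0 mul1r.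
have -> : ((u t)^-1 * r) ^+ 2 = r ^+ 2 + (r * t) ^+ 2 by rewrite exprMn ui2; ring.
have -> : `|(u t)^-1 * r| ^+ n.+1 = (u t ^+ n.+1)^-1 * `|r| ^+ n.+1.
  by rewrite normrM normfV (gtr0_norm (u0 t)) exprMn exprVn.
have un0 : u t ^+ n.+1 != 0 by rewrite expf_neq0// gt_eqF.
rewrite -[in RHS](mulrA _^-1) mulVKf// mulrCA -expRD; congr (_ * expR _).
by rewrite mulrDl opprD addrC.
Qed.

(** Given the first coordinate, the sum is its square plus a chi-square variable in the other n + 1;
    [chi_kernel_plane] then merges the two kernels. *)
Lemma chi_square_lawS (n : nat) (c : \bar R) : (0 <= c)%E ->
  chi_square_law n c -> exists2 c', (0 <= c')%E & chi_square_law n.+1 c'.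
Proof.
move=> c0 Hc.
exists ((normal_peak 1)%:E * c *
   \int[mu]_t ((Num.sqrt (1 + t ^+ 2))^-1 ^+ n.+2)%:E)%E.
  rewrite !mule_ge0 ?lee_fin ?normal_peak_ge0//.
  by apply: integral_ge0 => t _; rewrite lee_fin exprn_ge0// invr_ge0.
move=> d T P X gX f mf f0.
pose F (x : @cyl R 'I_n.+2) := f (\sum_i x i ^+ 2).
have mF : measurable_fun setT F.
  apply: (measurableT_comp mf); apply: measurable_sum => i.
  by apply: measurable_funX; exact: measurable_coord.
have F0 x : (0 <= F x)%E by exact: f0.
rewrite (ge0_gaussian_decouple gX (pred1 ord0) mF F0).
have gX' := gaussian_family_sub gX (@lift_inj n.+2 ord0).
have k0 m r : (0 <= (chi_kernel m r)%:E)%E by rewrite lee_fin chi_kernel_ge0.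
have msq : measurable_fun setT (fun r : R => r ^+ 2) by exact: measurable_funX.
pose H (z : R * R) := (f (z.1 ^+ 2 + z.2 ^+ 2)%R * (chi_kernel n z.2)%:E)%E.
have mH : measurable_fun setT H.
  apply: emeasurable_funM; last exact: (measurableT_comp (measurable_chi_kernelE n)).
  apply: (measurableT_comp mf).
  by apply: measurable_funD; exact: (measurableT_comp msq).
have H0 z : (0 <= H z)%E by rewrite mule_ge0.
pose h x := (c * \int[mu]_r H (x, r))%E.
have mh : measurable_fun setT h.
  apply: measurable_funeM; exact: (@measurable_fun_fubini_tonelli_F _ _ _ _ _ mu H).
have h0 x : (0 <= h x)%E by rewrite mule_ge0// integral_ge0.
transitivity (\int[P]_w h (X ord0 w))%E.
  apply: eq_integral => w _.
  have mfw : measurable_fun setT (fun y => f (X ord0 w ^+ 2 + y)).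
    by apply: (measurableT_comp mf); exact: measurable_funD.
  apply: etrans (Hc _ _ _ _ gX' (fun y => f (X ord0 w ^+ 2 + y)) mfw _) => //.
  by apply: eq_integral => w2 _; rewrite /F /= big_ord_recl.
rewrite (ge0_integral_gaussian_coord gX ord0 mh h0).
transitivity (\int[mu]_x ((normal_peak 1)%:E * c * \int[mu]_r
   (f (x ^+ 2 + r ^+ 2)%R * (chi_kernel 0 x * chi_kernel n r)%:E)))%E.
  apply: eq_integral => x _; rewrite /h normal_pdf01E EFinM.
  rewrite [LHS]muleC -[LHS]muleA -[RHS]muleA; congr (_ * _)%E.
  rewrite muleCA; congr (_ * _)%E.
  rewrite -ge0_integralZl//; last first.
    exact: (measurableT_comp mH).
  apply: eq_integral => r _; rewrite /H /= muleCA -EFinM.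
  by rewrite {2}/chi_kernel expr0 mul1r.
rewrite ge0_integralZl//; last 3 first.
- pose F2 (z : R * R) := (f (z.1 ^+ 2 + z.2 ^+ 2)%R * (chi_kernel 0 z.1 * chi_kernel n z.2)%:E)%E.
  apply: (@measurable_fun_fubini_tonelli_F _ _ _ _ _ mu F2) => //.
    rewrite /F2; under eq_fun do rewrite EFinM muleCA muleC.
    apply: emeasurable_funM => //.
    exact: (measurableT_comp (measurable_chi_kernelE 0)).
  by move=> z; rewrite /F2 mule_ge0// EFinM mule_ge0.
- by move=> x _; apply: integral_ge0 => r _; rewrite mule_ge0// EFinM mule_ge0.
- by rewrite mule_ge0// lee_fin normal_peak_ge0.
by rewrite chi_kernel_plane// muleA.
Qed.

Lemma chi_square_density (n : nat) (J : R) : 0 < J ->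
  (\int[mu]_r (chi_kernel n r)%:E)%E = J%:E -> chi_square_law n J^-1%:E.
Proof.
move=> J0 HJ.
have [c c0 Hc] : exists2 c, (0 <= c)%E & chi_square_law n c.
  elim: n {HJ} => [|n [c c0 Hc]]; last exact: chi_square_lawS c0 Hc.
  exists (normal_peak 1)%:E; last exact: chi_square_law0.
  by rewrite lee_fin normal_peak_ge0.
move=> d T P X gX f mf f0.
rewrite (Hc _ _ _ _ gX f mf f0); congr (_ * _)%E.
have f1 (x : R) : (0 <= cst 1%E x :> \bar R)%E by [].
(* Testing with f = 1 gives 1 = c * J, which excludes an infinite [c] and determines a finite
   one. *)
have := Hc _ _ _ _ gX (cst 1%E) (@measurable_cst _ _ _ _ _ _) f1.
have -> : (\int[P]_w cst 1 (\sum_i X i w ^+ 2)%R = 1)%E.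
  by apply: etrans (integral_cst P measurableT 1%E) _; rewrite mul1e; exact: probability_setT.
under eq_integral do rewrite mul1e.
rewrite HJ; case: c {Hc} c0 => [r _|_|//].
  rewrite -EFinM => -[E]; congr EFin.
  have J1 : J != 0 by rewrite gt_eqF.
  by apply: (mulIf J1); rewrite mulVf.
by rewrite gt0_mulye.
Qed.

End chi_square.

(** * Reduction of the Gram determinant *)

Section givens.
Context {R : realType}.

(** The two facts about an orthogonal map that are needed. Both pass to compositions, so plane
    rotations can be chained without forming an orthogonal matrix. *)
Definition gaussian_isometry (n : nat) (rho : ('I_n -> R) -> 'I_n -> R) : Prop :=
  (forall x y, \sum_r rho x r * rho y r = \sum_r x r * y r) /\
  forall (q : nat) (d : measure_display) (T : measurableType d)
    (P : probability T R) (B : 'I_n * 'I_q -> T -> R), gaussian_family P B ->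
  gaussian_family P (fun rj w => rho (fun r => B (r, rj.2) w) rj.1).

Lemma gaussian_isometry_id (n : nat) : gaussian_isometry (@id ('I_n -> R)).
Proof.
split=> // q d T P B gB.
by rewrite (_ : (fun _ => _) = B)//; apply/funext => -[r j].
Qed.

Lemma gaussian_isometry_comp (n : nat) (rho rho' : ('I_n -> R) -> 'I_n -> R) :
  gaussian_isometry rho -> gaussian_isometry rho' ->
  gaussian_isometry (rho \o rho').
Proof.
move=> [H1 G1] [H2 G2]; split=> [x y|q d T P B gB]; first by rewrite /= H1 H2.
exact: G1 (G2 _ _ _ _ _ gB).
Qed.

Definition givens (n : nat) (i : 'I_n.+1) (c s : R) (x : 'I_n.+1 -> R)
    (r : 'I_n.+1) : R :=
  if r == ord0 then c * x ord0 + s * x i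
  else if r == i then - s * x ord0 + c * x i else x r.

(** In [Bk k] the first [k] columns have been rotated. Going to k + 1 rotates a single pair of
    entries, an instance of [gaussian_family_rotate_pair]. *)
Lemma gaussian_isometry_givens (n : nat) (i : 'I_n.+1) (c s : R) :
  i != ord0 -> c ^+ 2 + s ^+ 2 = 1 -> c != 0 ->
  gaussian_isometry (givens i c s).
Proof.
move=> i0 cs1 c0; have i0' : ord0 != i by rewrite eq_sym.
split=> [x y|q d T P B gB].
  rewrite (bigD1 ord0)//= (bigD1 i)//= [RHS](bigD1 ord0)//= [in RHS](bigD1 i)//=.
  rewrite !addrA; congr (_ + _).
    rewrite /givens !eqxx (negbTE i0).
    transitivity ((c ^+ 2 + s ^+ 2) * (x ord0 * y ord0 + x i * y i)); first by ring.
    by rewrite cs1 mul1r.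
  by apply: eq_bigr => r /andP[/negbTE r0 /negbTE ri]; rewrite /givens r0 ri.
pose Bk (k : nat) (rj : 'I_n.+1 * 'I_q) (w : T) : R :=
  if (rj.2 < k)%N then givens i c s (fun r => B (r, rj.2) w) rj.1 else B rj w.
suff H k : (k <= q)%N -> gaussian_family P (Bk k).
  have := H q (leqnn q); congr gaussian_family.
  by apply/funext => rj; apply/funext => w; rewrite /Bk ltn_ord.
elim: k => [_|k IH kq].
  by rewrite (_ : Bk 0%N = B)//; apply/funext => -[r j]; apply/funext.
pose j0 : 'I_q := Ordinal kq.
have ab : (ord0, j0) != (i, j0) :> 'I_n.+1 * 'I_q by rewrite xpair_eqE (negbTE i0').
have := gaussian_family_rotate_pair (IH (ltnW kq)) ab cs1 c0.
congr gaussian_family; apply/funext => -[r j]; apply/funext => w.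
rewrite /rotate_pair /Bk /= !xpair_eqE ltnn.
have E : (j < k.+1)%N = (j == k :> nat) || (j < k)%N by rewrite ltnS leq_eqVlt.
rewrite E.
have -> : (j == j0) = (j == k :> nat) by rewrite -val_eqE.
have [jk|_] := boolP (j == k :> nat); last by rewrite !andbF.
have -> : j = j0 by apply/val_inj/eqP.
by rewrite !andbT ltnn /givens.
Qed.

(** Rotations in the planes of coordinates 0 and i clear the entries one by one. Keeping the first
    entry nonzero keeps the cosine a / t nonzero. *)
Lemma gaussian_isometry_reduce (n : nat) (v : 'I_n.+1 -> R) : v ord0 != 0 ->
  exists2 rho, gaussian_isometry rho & forall r, r != ord0 -> rho v r = 0.
Proof.
move=> v0.
suff [rho [Hr _ H]] : exists rho : ('I_n.+1 -> R) -> 'I_n.+1 -> R,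
    [/\ gaussian_isometry rho, rho v ord0 != 0 &
    forall r : 'I_n.+1, r != ord0 -> (r <= n)%N -> rho v r = 0].
  by exists rho => // r r0; apply: H => //; rewrite -ltnS.
suff : forall k, (k <= n)%N -> exists rho : ('I_n.+1 -> R) -> 'I_n.+1 -> R,
    [/\ gaussian_isometry rho, rho v ord0 != 0 &
    forall r : 'I_n.+1, r != ord0 -> (r <= k)%N -> rho v r = 0] by apply.
elim=> [_|k IH kn].
  exists id; split => //; first exact: gaussian_isometry_id.
  by move=> r r0; rewrite leqn0 => /eqP r00; case/eqP: r0; apply: val_inj.
have [rho [Hr r0 H]] := IH (ltnW kn).
pose i : 'I_n.+1 := Ordinal (kn : (k.+1 < n.+1)%N).
have i0 : i != ord0 by [].
pose a := rho v ord0; pose b := rho v i.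
pose t := Num.sqrt (a ^+ 2 + b ^+ 2).
have t2 : t ^+ 2 = a ^+ 2 + b ^+ 2 by rewrite sqr_sqrtr// addr_ge0// sqr_ge0.
have t2p : 0 < a ^+ 2 + b ^+ 2.
  by rewrite ltr_pwDl ?sqr_ge0// lt_neqAle sqr_ge0 andbT eq_sym sqrf_eq0.
have t0 : t != 0 by rewrite -sqrf_eq0 t2 gt_eqF.
have cs1 : (a / t) ^+ 2 + (b / t) ^+ 2 = 1.
  by rewrite !expr_div_n -mulrDl -t2 divff// sqrf_eq0.
have c0 : a / t != 0 by rewrite mulf_neq0// invr_neq0.
exists (givens i (a / t) (b / t) \o rho); split.
- apply: gaussian_isometry_comp => //; exact: gaussian_isometry_givens.
- rewrite /= /givens eqxx -/a -/b.
  rewrite [_ / t * a]mulrAC [_ / t * b]mulrAC -mulrDl -!expr2 -t2 expr2 mulfK//.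
move=> r rn0; rewrite leq_eqVlt => /orP[/eqP rk|]; last first.
  rewrite ltnS => rk; rewrite /= /givens (negbTE rn0) ifF; first exact: H.
  by apply/negbTE; rewrite -val_eqE /= neq_ltn ltnS rk.
have -> : r = i by apply: val_inj.
rewrite /= /givens (negbTE i0) eqxx -/a -/b.
by rewrite mulNr [_ / t * a]mulrAC [_ / t * b]mulrAC [b * a]mulrC addNr.
Qed.

Definition gram (n p : nat) (x : 'I_n * 'I_p -> R) : 'M[R]_p :=
  \matrix_(j, k) \sum_r x (r, j) * x (r, k).

Lemma gram_isometry (n p : nat) (rho : ('I_n -> R) -> 'I_n -> R)
    (x : 'I_n * 'I_p -> R) : gaussian_isometry rho ->
  gram (fun rj => rho (fun r => x (r, rj.2)) rj.1) = gram x.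
Proof. move=> [H _]; apply/matrixP => j k; rewrite !mxE.
exact: (H (fun r => x (r, j)) (fun r => x (r, k))). Qed.

(** When the first column is (a, 0, ..., 0), the Gram matrix equals U^T D U with U = [a b; 0 1] and
    D = [1 0; 0 G]. Nothing is divided by a, so a = 0 is included. *)
Lemma det_gram_reduced (n p : nat) (x : 'I_n.+1 * 'I_p.+1 -> R) :
  (forall r, r != ord0 -> x (r, ord0) = 0) ->
  \det (gram x) = x (ord0, ord0) ^+ 2 *
    \det (gram (fun rj : 'I_n * 'I_p => x (lift ord0 rj.1, lift ord0 rj.2))).
Proof.
move=> x0; set a := x (ord0, ord0).
set G := gram (fun rj : 'I_n * 'I_p => _).
pose b : 'rV[R]_p := \row_k x (ord0, lift ord0 k).
pose U : 'M[R]_(1 + p) := block_mx a%:M b 0 1%:M.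
pose D : 'M[R]_(1 + p) := block_mx 1%:M 0 0 G.
have -> : gram x = U^T *m (D *m U) :> 'M[R]_(1 + p).
  have -> : U^T *m (D *m U) =
      block_mx (a ^+ 2)%:M (a *: b) (a *: b^T) (b^T *m b + G) :> 'M[R]_(1 + p).
    rewrite /D /U mulmx_block tr_block_mx mulmx_block.
    rewrite !(mul1mx, mul0mx, mulmx0, mulmx1, addr0, add0r, trmx0, trmx1).
    rewrite tr_scalar_mx -scalar_mxM mul_scalar_mx -expr2; congr block_mx.
    by rewrite mul_mx_scalar.
  have E0 : ord0 = lshift p (ord0 : 'I_1) by apply: val_inj.
  have E1 (j : 'I_p) : lift ord0 j = rshift 1 j by apply: val_inj.
  apply/matrixP => j k.
  case: (unliftP ord0 j) => [j'|] ->; case: (unliftP ord0 k) => [k'|] ->.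
  - rewrite [in RHS]E1 [in RHS](E1 k') block_mxEdr !mxE big_ord_recl big_ord1 !mxE.
    by congr (_ + _).
  - rewrite [in RHS]E1 [in RHS]E0 block_mxEdl !mxE big_ord_recl big1 ?addr0.
      by rewrite mulrC.
    by move=> r _; rewrite [X in _ * X]x0 ?mulr0.
  - rewrite [in RHS](E1 k') [in RHS]E0 block_mxEur !mxE big_ord_recl big1 ?addr0//.
    by move=> r _; rewrite x0 ?mul0r.
  - rewrite [in RHS]E0 block_mxEul !mxE big_ord_recl big1 ?addr0 ?mulr1n//.
    by move=> r _; rewrite x0 ?mul0r.
have dU : \det U = a.
  apply: etrans (@det_ublock _ 1 p a%:M b 1%:M) _.
  by rewrite det1 det_scalar1 mulr1.
have dD : \det D = \det G.
  by apply: etrans (@det_ublock _ 1 p 1%:M 0 G) _; rewrite det1 mul1r.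
by rewrite !det_mulmx det_tr dU dD; ring.
Qed.

End givens.

(** * Moment sequences, mixtures, and induction on the number of columns *)

Section moments.
Context {R : realType}.

Definition has_moments (d : measure_display) (T : measurableType d)
    (P : probability T R) (Y : T -> R) (m : nat -> R) : Prop :=
  measurable_fun setT Y /\
  forall i, P.-integrable setT (fun w => (Y w ^+ i)%:E) /\
    (\int[P]_w (Y w ^+ i)%:E = (i`!%:R * m i)%:E)%E.

Definition exp_coef (a : R) (i : nat) : R := a ^+ i / i`!%:R.

Lemma fact_neq0 (i : nat) : i`!%:R != 0 :> R.
Proof. by rewrite pnatr_eq0 -lt0n fact_gt0. Qed.

Lemma exprD_exp_coef (a y : R) (i : nat) :
  (a + y) ^+ i = \sum_(j < i.+1) (i`!%:R * exp_coef a j / (i - j)`!%:R) * y ^+ (i - j).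
Proof.
rewrite addrC exprDn; apply: eq_bigr => j _.
rewrite -mulr_natr mulrC -(bin_fact (ltn_ord j : (j <= i)%N)) !natrM /exp_coef.
have := fact_neq0 j; have := fact_neq0 (i - j).
set A := _`!%:R; set B := _`!%:R => A0 B0; field.
by rewrite A0 B0.
Qed.

Lemma ler_1sqr (y : R) : y <= 1 + y ^+ 2.
Proof. by have := sqr_ge0 (y - 1); have := sqr_ge0 y; nra. Qed.

Section transform.
Context d (T : measurableType d) (P : probability T R).

Lemma has_moments_shift (y : T -> R) (m : nat -> R) (a : R) :
  has_moments P y m -> has_moments P (fun w => a + y w) (cauchy_prod (exp_coef a) m).
Proof.
move=> [my Hm]; split; first exact: measurable_funD.
move=> i.
pose c (j : 'I_i.+1) := i`!%:R * exp_coef a j / (i - j)`!%:R.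
have E w : ((a + y w) ^+ i)%:E = (\sum_(j < i.+1) (c j)%:E * (y w ^+ (i - j))%:E)%E.
  by rewrite exprD_exp_coef -sumEFin; apply: eq_bigr => j _; rewrite EFinM.
have I j : P.-integrable setT (fun w => (c j)%:E * (y w ^+ (i - j))%:E)%E.
  by apply: integrableZl => //; case: (Hm (i - j)%N).
under eq_fun do rewrite E.
split; first by apply: (integrable_sum measurableT) => j _; exact: I.
rewrite integral_sum//.
under eq_bigr => j _.
  have [Ij Ej] := Hm (i - j)%N.
  rewrite integralZl// Ej -EFinM.
  over.
rewrite sumEFin; congr EFin; rewrite /cauchy_prod mulr_sumr.
apply: eq_bigr => j _; rewrite /c mulrA -!mulrA; congr (_ * (_ * _)).
by rewrite mulKf// fact_neq0.
Qed.

Lemma has_moments_cst0 : has_moments P (cst 0) (fun i => (i == 0%N)%:R).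
Proof.
split=> // i; split; first exact: (finite_measure_integrable_cst P (0 ^+ i)).
apply: etrans (integral_cst P measurableT (0 ^+ i)%:E) _.
rewrite [X in (_ * X)%E](_ : _ = 1%E) ?mule1; last exact: probability_setT.
by case: i => [|i]; rewrite ?expr0 ?expr0n /= ?mulr0 ?mulr1.
Qed.

Variables (a : T -> R) (ma m : nat -> R) (F : T * T -> R).
Hypotheses (Ha : has_moments P a ma) (mF : measurable_fun setT F).
Hypothesis HF : {ae P, forall w1, has_moments P (fun w2 => F (w1, w2))
  (cauchy_prod (exp_coef (a w1)) m)}.

Let Q (i : nat) (w : T) : R := i`!%:R * cauchy_prod (exp_coef (a w)) m i.

Let integrable_Q i : P.-integrable setT (fun w => (Q i w)%:E) /\
  (\int[P]_w (Q i w)%:E = (i`!%:R * cauchy_prod ma m i)%:E)%E.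
Proof.
have [_ Hm] := Ha.
pose c (j : 'I_i.+1) := i`!%:R / j`!%:R * m (i - j)%N.
have E w : ((Q i w)%:E = \sum_(j < i.+1) (c j)%:E * (a w ^+ j)%:E)%E.
  rewrite /Q /cauchy_prod mulr_sumr -sumEFin; apply: eq_bigr => j _.
  by rewrite -EFinM; congr EFin; rewrite /c /exp_coef; ring.
have I j : P.-integrable setT (fun w => (c j)%:E * (a w ^+ j)%:E)%E.
  by apply: integrableZl => //; case: (Hm j).
under eq_fun do rewrite E.
split; first by apply: (integrable_sum measurableT) => j _; exact: I.
rewrite integral_sum//.
under eq_bigr => j _.
  have [Ij Ej] := Hm j.
  rewrite integralZl// Ej -EFinM.
  over.
rewrite sumEFin; congr EFin; rewrite /cauchy_prod mulr_sumr.
apply: eq_bigr => j _; rewrite /c.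
by rewrite mulrACA -[_ / _ * _]mulrA mulVf ?fact_neq0// mulr1; ring.
Qed.

Let mFi i : measurable_fun setT (fun z => (F z ^+ i)%:E).
Proof. by apply/measurable_EFinP; exact: measurable_funX. Qed.

(** By [HF], given [w1] the moments of [F] are those of a(w1) plus a variable with moments [m].
    Absolute moments are not given by this, so |F^i| is bounded by 1 + F^(2i), whose conditional
    mean involves only the polynomial [Q (i * 2)] in a(w1). *)
Lemma moments_mixture_lty i :
  (\int[P]_w1 \int[P]_w2 `|(F (w1, w2) ^+ i)%:E| < +oo)%E.
Proof.
have [iQ _] := integrable_Q (i * 2).
pose H w := (1 + `|(Q (i * 2) w)%:E|)%E.
have iH : P.-integrable setT H.
  by apply: integrableD => //; [exact: finite_measure_integrable_cst|exact: integrable_abse].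
have := iH => /integrableP[mH]; apply: le_lt_trans.
apply: ae_ge0_le_integral => //.
- by move=> w _; exact: integral_ge0.
- apply: (@measurable_fun_fubini_tonelli_F _ _ _ _ _ P (fun z => `|(F z ^+ i)%:E|%E)) => //.
  exact: measurableT_comp.
- exact: measurableT_comp.
have := HF; apply: filterS => w1 [mF1 H1] _.
have [iF EF] := H1 (i * 2)%N.
apply: (@le_trans _ _ (\int[P]_w2 (1 + (F (w1, w2) ^+ (i * 2))%:E))%E).
  apply: ge0_le_integral => //.
  - by apply: measurableT_comp => //; exact: (measurableT_comp (mFi i)).
  - by apply: emeasurable_funD => //; exact: (measurableT_comp (mFi _)).
  move=> w2 _; rewrite abse_EFin -EFinD lee_fin exprM.
  set x := _ ^+ i; rewrite -real_normK ?num_real//; set y := `|x|.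
  exact: ler_1sqr.
rewrite integralD//; last exact: finite_measure_integrable_cst.
rewrite EF integral_cst// mul1e.
rewrite [X in (X + _)%E](_ : _ = 1%E); last exact: probability_setT.
by rewrite /H gee0_abs ?adde_ge0// leeD2l// lee_abs.
Qed.

Lemma moments_mixture i :
  (\int[P]_w1 \int[P]_w2 (F (w1, w2) ^+ i)%:E =
   (i`!%:R * cauchy_prod ma m i)%:E)%E.
Proof.
have [iQ <-] := integrable_Q i.
have iF : (P \x P)%E.-integrable setT (fun z => (F z ^+ i)%:E).
  by apply/(integrable12ltyP P P (mFi i)); exact: moments_mixture_lty.
apply: ae_eq_integral => //.
- exact: (@measurable_fubini_F _ _ _ _ _ P P _ iF).
- by case/integrableP : iQ.
by have := HF; apply: filterS => w1 [_ H1] _; have [_ ->] := H1 i.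
Qed.

End transform.
End moments.

Section gram_moments.
Context {R : realType}.

Lemma measurable_det_gram (n p : nat) :
  measurable_fun setT (fun x : @cyl R ('I_n * 'I_p)%type => \det (gram x)).
Proof.
apply: measurable_sum => s; apply: measurable_funM => //.
apply: measurable_prod => j _ /=.
under eq_fun do rewrite mxE.
apply: measurable_sum => r.
by apply: measurable_funM; exact: measurable_coord.
Qed.

Lemma gaussian_coord_neq0 (I : finType) d (T : measurableType d)
    (P : probability T R) (X : I -> T -> R) (i : I) : gaussian_family P X ->
  {ae P, forall w, X i w != 0}.
Proof.
move=> gX; exists (X i @^-1` [set 0]); split.
- have [mX _] := gX.
  by rewrite -[X in measurable X]setTI; exact: mX.
- rewrite (gaussian_coord gX)//.
  have /null_content_dominatesP dom := @normal_prob_dominates R 0 1.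
  by apply: dom => //; exact: lebesgue_measure_set1.
by move=> w /=; apply: contra_notP => /eqP.
Qed.

Definition log_chi_square_moments (n : nat) (L : nat -> R) : Prop :=
  forall (d : measure_display) (T : measurableType d) (P : probability T R)
    (X : 'I_n.+1 -> T -> R), gaussian_family P X ->
  has_moments P (fun w => ln (\sum_i X i w ^+ 2)) L.

(** Index q of [L] stands for q + 1 degrees of freedom, and q runs from n - 1 down to n - p. The
    base case is the sequence of the constant 0, the log-determinant of an empty matrix. *)
Fixpoint gram_log_moments (L : nat -> nat -> R) (n p : nat) : nat -> R :=
  match n, p with
  | n'.+1, p'.+1 => cauchy_prod (L n') (gram_log_moments L n' p')
  | _, _ => fun i => (i == 0%N)%:R
  end.

Section split_first_column.
Context (n p : nat) d (T : measurableType d) (P : probability T R)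
  (A : 'I_n.+1 * 'I_p.+1 -> T -> R).
Hypothesis gA : gaussian_family P A.

Definition split_column (w1 w2 : T) (rj : 'I_n.+1 * 'I_p.+1) : R :=
  if rj.2 == ord0 then A rj w1 else A rj w2.

(* For a fixed first column [v], an isometry sends [v] to a multiple of the
   first basis vector and leaves the other columns Gaussian. *)
Lemma det_gram_split (w1 : T) : A (ord0, ord0) w1 != 0 ->
  exists2 C : 'I_n * 'I_p -> T -> R, gaussian_family P C &
  forall w2, \det (gram (split_column w1 w2)) =
    (\sum_r A (r, ord0) w1 ^+ 2) * \det (gram (fun rj => C rj w2)).
Proof.
move=> v0; have [rho grho rho0] := gaussian_isometry_reduce (v := fun r => A (r, ord0) w1) v0.
have [rhoE rhoG] := grho.
pose A'' (rj : 'I_n.+1 * 'I_p) := A (rj.1, lift ord0 rj.2).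
have hinj : injective (fun rj : 'I_n.+1 * 'I_p => (rj.1, lift ord0 rj.2)).
  move=> [r j] [r' j'] /= E; have := congr1 snd E; have := congr1 fst E.
  by move=> /= -> /lift_inj ->.
have gA'' : gaussian_family P A'' := gaussian_family_sub gA hinj.
pose B := fun (rj : 'I_n.+1 * 'I_p) w => rho (fun r => A'' (r, rj.2) w) rj.1.
have gB : gaussian_family P B := rhoG _ _ _ _ _ gA''.
have kinj : injective (fun rj : 'I_n * 'I_p => (lift ord0 rj.1, rj.2)).
  move=> [r j] [r' j'] /= E; have := congr1 snd E; have := congr1 fst E.
  by move=> /= /lift_inj -> ->.
exists (fun rj => B (lift ord0 rj.1, rj.2)); first exact: (gaussian_family_sub gB kinj).
move=> w2; rewrite -(gram_isometry _ grho) det_gram_reduced; last first.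
  by move=> r r0 /=; rewrite /split_column /=; exact: rho0.
congr (_ * _).
  rewrite [LHS]expr2 -[RHS](eq_bigr _ (fun r _ => esym (expr2 _))) -rhoE.
  rewrite (bigD1 ord0)//= big1 ?addr0; first by [].
  by move=> r r0; rewrite rho0 ?mul0r.
Qed.

End split_first_column.

(** Induction on the number of columns, conditioning on the first. Positivity is carried along
    because [lnM] splits the logarithm only for positive factors. *)
Lemma gram_has_moments (L : nat -> nat -> R) (p n : nat) :
  (forall n, log_chi_square_moments n (L n)) -> (p <= n)%N ->
  forall d (T : measurableType d) (P : probability T R)
    (A : 'I_n * 'I_p -> T -> R), gaussian_family P A ->
  has_moments P (fun w => ln (\det (gram (fun rj => A rj w))))
    (gram_log_moments L n p) /\
  {ae P, forall w, 0 < \det (gram (fun rj => A rj w))}.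
Proof.
move=> HL; elim: p n => [|p IH] n pn d T P A gA.
  have E w : \det (gram (fun rj => A rj w)) = 1 by exact: det_mx00.
  split; last by apply: aeW => w; rewrite E.
  have -> : (fun w => ln (\det (gram (fun rj => A rj w)))) = cst 0.
    by apply/funext => w; rewrite E ln1.
  have -> : gram_log_moments L n 0 = fun i => (i == 0%N)%:R by case: (n).
  exact: has_moments_cst0.
case: n pn A gA => // n pn A gA.
pose F (x : @cyl R ('I_n.+1 * 'I_p.+1)%type) := ln (\det (gram x)).
have mF : measurable_fun setT F.
  by apply: measurableT_comp => //; exact: measurable_det_gram.
have [mA _] := gA.
have mS : measurable_fun setT (fun z : T * T =>
    (split_column A z.1 z.2 : @cyl R ('I_n.+1 * 'I_p.+1)%type)).
  apply: measurable_into_cyl => -[r j]; rewrite /split_column /=.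
  by case: (j == ord0); exact: (measurableT_comp (mA _)).
have colinj : injective (fun r : 'I_n.+1 => (r, ord0 : 'I_p.+1)) by move=> r r' [].
have gv := gaussian_family_sub gA colinj.
have ae0 := gaussian_coord_neq0 (ord0, ord0) gA.
have Spos w1 : A (ord0, ord0) w1 != 0 -> 0 < \sum_r A (r, ord0) w1 ^+ 2.
  move=> v0; rewrite big_ord_recl ltr_pwDl//.
    by rewrite lt_neqAle sqr_ge0 andbT eq_sym sqrf_eq0.
  by apply: sumr_ge0 => r _; exact: sqr_ge0.
have inner : {ae P, forall w1,
    has_moments P (fun w2 => F (split_column A w1 w2))
     (cauchy_prod (exp_coef (ln (\sum_r A (r, ord0) w1 ^+ 2)))
       (gram_log_moments L n p)) /\
    {ae P, forall w2, 0 < \det (gram (split_column A w1 w2))}}.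
  move: ae0; apply: filterS => w1 v0.
  have [C gC EC] := det_gram_split gA v0.
  have [mC pC] := IH n pn _ _ _ _ gC.
  have s0 := Spos _ v0.
  split; last by move: pC; apply: filterS => w2 ?; rewrite EC mulr_gt0.
  have [_ Hs] := has_moments_shift (ln (\sum_r A (r, ord0) w1 ^+ 2)) mC.
  have mF1 : measurable_fun setT (fun w2 => F (split_column A w1 w2)).
    apply: (measurableT_comp mF); apply: measurable_into_cyl => -[r j].
    by rewrite /split_column /=; case: (j == ord0).
  split => // i; have [Is <-] := Hs i.
  have aeE : ae_eq P setT (fun w2 => (F (split_column A w1 w2) ^+ i)%:E)
    (fun w2 => ((ln (\sum_r A (r, ord0) w1 ^+ 2) +
        ln (\det (gram (fun rj => C rj w2)))) ^+ i)%:E).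
    move: pC; apply: filterS => w2 c0 _; rewrite /F EC lnM//.
  have mFi : measurable_fun setT (fun w2 => (F (split_column A w1 w2) ^+ i)%:E).
    by apply/measurable_EFinP; exact: measurable_funX.
  have mCi := measurable_int P Is.
  split; last exact: ae_eq_integral.
  apply/integrableP; split => //.
  have/integrableP[_] := Is; apply: le_lt_trans.
  rewrite le_eqVlt; apply/orP; left; apply/eqP.
  apply: ge0_ae_eq_integral => //; try exact: measurableT_comp.
  by move: aeE; apply: filterS => w2 E Tw; rewrite (E Tw).
have pos : {ae P, forall w, 0 < \det (gram (fun rj => A rj w))}.
  (* By resampling, the probability of [N] is an integral of conditional probabilities that vanish
     for almost every first column. *)
  pose N : set (@cyl R ('I_n.+1 * 'I_p.+1)%type) := [set x | \det (gram x) <= 0].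
  have mN : measurable N.
    have -> : N = (fun x => \det (gram x)) @^-1` `]-oo, 0].
      by apply/seteqP; split => x; rewrite /N /= in_itv.
    rewrite -[X in measurable X]setTI.
    exact: (@measurable_det_gram n.+1 p.+1 measurableT _ (measurable_itv `]-oo, 0])).
  have mAN : measurable [set w | N (fun rj => A rj w)].
    by have := measurable_into_cyl mA measurableT mN; rewrite setTI.
  exists [set w | N (fun rj => A rj w)]; split => //.
    have m1 : measurable_fun setT (fun x => (\1_N x)%:E : \bar R).
      by apply/measurable_EFinP; exact: measurable_indic.
    have := ge0_gaussian_decouple gA (fun rj => rj.2 == ord0) m1 (fun x => _).
    rewrite -[RHS]/(\int[P]_w1 \int[P]_w2 (\1_N (split_column A w1 w2))%:E)%E.
    move=> EN; apply: etrans (etrans _ (EN _)) _.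
    - have := integral_indic P measurableT mAN.
      by rewrite setIT => <-.
    - by move=> x; rewrite lee_fin.
    - transitivity (\int[P]_w1 (cst 0%E w1))%E; last exact: integral0.
      have m1' : measurable_fun setT (fun z : T * T => (\1_N (split_column A z.1 z.2))%:E : \bar R).
        exact: (measurableT_comp m1 mS).
      apply: ge0_ae_eq_integral => //.
      + apply: (@measurable_fun_fubini_tonelli_F _ _ _ _ _ P
          (fun z : T * T => (\1_N (split_column A z.1 z.2))%:E)) => //.
      + by move=> w _; apply: integral_ge0 => w2 _; rewrite lee_fin.
      move: inner; apply: filterS => w1 [_ H] _.
      transitivity (\int[P]_w2 (cst 0%E w2))%E; last exact: integral0.
      apply: ge0_ae_eq_integral => //.
        exact: (@measurable_fun_pair2 _ _ _ _ _ _
          (fun z : T * T => (\1_N (split_column A z.1 z.2))%:E) w1 m1').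
      move: H; apply: filterS => w2 H _ /=; rewrite indicE memNset//.
      by rewrite /N /= leNgt H.
  by move=> w /=; apply: contra_notP; rewrite /N /= => /negP; rewrite -ltNge.
split=> //.
split.
  by apply: (measurableT_comp mF); exact: measurable_into_cyl.
move=> i.
have mFi : measurable_fun setT (fun x => (F x ^+ i)%:E).
  by apply/measurable_EFinP; exact: measurable_funX.
have HF : {ae P, forall w1, has_moments P (fun w2 => F (split_column A w1 w2))
     (cauchy_prod (exp_coef (ln (\sum_r A (r, ord0) w1 ^+ 2)))
       (gram_log_moments L n p))}.
  by move: inner; apply: filterS => w1 [].
have Hv := HL n _ _ _ _ gv.
have mFz : measurable_fun setT (fun z : T * T => F (split_column A z.1 z.2)).
  exact: (measurableT_comp mF mS).
have lty := moments_mixture_lty Hv mFz HF i.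
have [iF EF] := gaussian_decouple (J := fun rj => rj.2 == ord0) gA mFi lty.
by split => //; rewrite EF; exact: (moments_mixture Hv mFz HF).
Qed.

End gram_moments.

(** * Logarithmic moments of the chi-square law *)

Section half_line.
Context {R : realType}.
Local Notation mu := (@lebesgue_measure R).
Local Notation half := (`]0%R, +oo[%classic : set R).

(** Compact intervals that exhaust the half-line. With k + 2 in place of k + 1 they are
    nondegenerate already at k = 0. *)
Let A (k : nat) : set R := `[k.+2%:R^-1, k.+2%:R]%classic.

Let A_nd : nondecreasing_seq A.
Proof.
move=> k l kl; apply/subsetPset => x; rewrite /A /= !in_itv /= => /andP[kx xk].
apply/andP; split; last by apply: le_trans xk _; rewrite ler_nat !ltnS.
by apply: le_trans kx; rewrite lef_pV2 ?posrE ?ltr0n// ler_nat !ltnS.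
Qed.

Let A_cover : \bigcup_k A k = half.
Proof.
apply/seteqP; split => x /=.
  move=> [k _]; rewrite /A /= !in_itv /= => /andP[kx _].
  by rewrite andbT; apply: lt_le_trans kx; rewrite invr_gt0 ltr0n.
rewrite in_itv /= andbT => x0.
pose k := Num.truncn (x + x^-1).
have xk : x + x^-1 < k.+2%:R.
  apply: (@lt_trans _ _ k.+1%:R); last by rewrite ltr_nat.
  by rewrite truncnS_gt.
have xV0 : 0 < x^-1 by rewrite invr_gt0.
exists k => //; rewrite /A /= in_itv /=; apply/andP; split; last by lra.
rewrite -[leRHS]invrK lef_pV2 ?posrE ?ltr0n//; lra.
Qed.

Let A_half k : A k `<=` half.
Proof. by rewrite -A_cover; exact: bigcup_sup. Qed.

Variables (F f : R -> R).
Hypotheses (dF : forall r : R, 0 < r -> is_derive r 1 F (f r))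
  (cf : forall r : R, 0 < r -> {for r, continuous f}).

Let FTC_A k : (\int[mu]_(x in A k) (f x)%:E = (F k.+2%:R - F k.+2%:R^-1)%:E)%E.
Proof.
have k0 : 0 < k.+2%:R^-1 :> R by rewrite invr_gt0 ltr0n.
have kk : k.+2%:R^-1 < k.+2%:R :> R.
  by apply: (@lt_trans _ _ 1); rewrite ?ltr1n// invf_lt1 ?ltr1n ?ltr0n.
have cF r : 0 < r -> {for r, continuous F}.
  move=> r0; apply: differentiable_continuous; apply/derivable1_diffP.
  by have [] := dF r0.
rewrite EFinB; apply: continuous_FTC2 => //.
- apply: continuous_in_subspaceT => x; rewrite inE /= in_itv /= => /andP[kx _].
  by apply: cf; exact: lt_le_trans kx.
- split.
  + move=> x; rewrite in_itv /= => /andP[kx _].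
    by have [] := dF (lt_trans k0 kx).
  + by apply: cvg_at_right_filter; exact: cF.
  + by apply: cvg_at_left_filter; apply: cF; exact: lt_trans kk.
- move=> x; rewrite in_itv /= => /andP[kx _].
  by rewrite derive1E; have [_ ->] := dF (lt_trans k0 kx).
Qed.

Lemma measurable_half : measurable_fun half f.
Proof.
apply: open_continuous_measurable_fun; first exact: interval_open.
by move=> x; rewrite inE /= in_itv /= andbT => /cf.
Qed.

Let mA k : measurable_fun (A k) f.
Proof. exact: (measurable_funS _ (@A_half k) measurable_half). Qed.

Let mAE k : measurable_fun (A k) (EFin \o f).
Proof. exact/measurable_EFinP. Qed.

Let half_gt0 r : half r -> 0 < r.
Proof. by rewrite /= in_itv /= andbT. Qed.

Lemma ge0_integral_half_le (C : R) : (forall r, 0 < r -> 0 <= f r) ->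
  (forall r, 0 < r -> 0 <= F r <= C) ->
  (\int[mu]_(x in half) (f x)%:E <= C%:E)%E.
Proof.
move=> f0 FC.
have cvgA : (\int[mu]_(x in A k) (f x)%:E @[k --> \oo] -->
    \int[mu]_(x in \bigcup_k A k) (f x)%:E)%E.
  apply: ge0_nondecreasing_set_cvg_integral => //.
  - by move=> k; exact: measurable_itv.
  - by move=> k x /A_half/half_gt0 x0; rewrite lee_fin f0.
rewrite -A_cover -(cvg_lim _ cvgA)//; apply: lime_le; first exact: cvgP cvgA.
apply: nearW => k; rewrite FTC_A lee_fin.
have k0 : 0 < k.+2%:R :> R by rewrite ltr0n.
have kV0 : 0 < k.+2%:R^-1 :> R by rewrite invr_gt0.
have /andP[_ H1] := FC _ k0; have /andP[H2 _] := FC _ kV0; lra.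
Unshelve. all: by end_near. Qed.

(** The integral over [A k] is a difference of boundary values. Integrability makes it converge to
    the full integral, by monotone convergence for the positive and negative parts. *)
Lemma integral_half_eq0 : mu.-integrable half (EFin \o f) ->
  F k.+2%:R @[k --> \oo] --> (0 : R) ->
  F k.+2%:R^-1 @[k --> \oo] --> (0 : R) ->
  (\int[mu]_(x in half) (f x)%:E = 0)%E.
Proof.
move=> If Foo F0.
have mAs k : measurable (A k) by exact: measurable_itv.
have cvgp : (\int[mu]_(x in A k) ((EFin \o f)^\+ x) @[k --> \oo] -->
    \int[mu]_(x in half) ((EFin \o f)^\+ x))%E.
  rewrite -A_cover; apply: ge0_nondecreasing_set_cvg_integral => //.
  by move=> k; apply: measurable_funepos; exact: mAE.
have cvgn : (\int[mu]_(x in A k) ((EFin \o f)^\- x) @[k --> \oo] -->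
    \int[mu]_(x in half) ((EFin \o f)^\- x))%E.
  rewrite -A_cover; apply: ge0_nondecreasing_set_cvg_integral => //.
  by move=> k; apply: measurable_funeneg; exact: mAE.
have fp : (\int[mu]_(x in half) ((EFin \o f)^\+ x))%E \is a fin_num.
  by apply: integrable_pos_fin_num.
have fn : (\int[mu]_(x in half) ((EFin \o f)^\- x))%E \is a fin_num.
  by apply: integrable_neg_fin_num.
have H1 : (\int[mu]_(x in A k) (f x)%:E @[k --> \oo] -->
    \int[mu]_(x in half) (f x)%:E)%E.
  rewrite [X in _ --> X]integralE.
  under eq_cvg do rewrite integralE.
  by apply: cvgeB => //; rewrite fin_num_adde_defl// fin_numN.
have H2 : (\int[mu]_(x in A k) (f x)%:E @[k --> \oo] --> 0)%E.
  under eq_cvg do rewrite FTC_A.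
  apply: cvg_EFin; first by apply: nearW.
  by rewrite -(subr0 0); exact: cvgB.
exact: cvg_unique H1 H2.
Qed.

End half_line.

Section log_power_kernel.
Context {R : realType}.
Local Notation mu := (@lebesgue_measure R).
Local Notation half := (`]0%R, +oo[%classic : set R).

Lemma exprn_le_expR (n : nat) (x : R) : 0 <= x -> x ^+ n <= n`!%:R * expR x.
Proof.
move=> x0; case: n => [|n].
  by rewrite expr0 mul1r; apply: le_trans (expR_ge1Dx x); rewrite lerDl.
have f0 : 0 < n.+1`!%:R :> R by rewrite ltr0n fact_gt0.
rewrite mulrC -ler_pdivrMr//; apply: le_trans (expR_ge1Dxn n x0).
by rewrite lerDr.
Qed.

Definition log_power (n i : nat) (r : R) : R :=
  ln (r ^+ 2) ^+ i * (r ^+ n * expR (- (r ^+ 2 / 2))).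

(* The derivative of [2 - 2 / (1 + sqrt r)], hence integrable on the half-line,
   and of order [r^(-1/2)] at [0]. *)
Definition sqrt_dominator (r : R) : R := (Num.sqrt r * (1 + Num.sqrt r) ^+ 2)^-1.

(** Here [s] stands for sqrt r, so the exponential is exp(- r^2 / 2). *)
Lemma exprn_quartic_bound (m : nat) (s : R) : 0 < s ->
  s ^+ m * expR (- (s ^+ 4 / 2)) <= 1 + m`!%:R * 2 ^+ m.
Proof.
move=> s0; set e := expR _.
have e0 : 0 < e by exact: expR_gt0.
have e1 : e <= 1 by rewrite -expR0 ler_expR oppr_le0 divr_ge0// exprn_ge0// ltW.
have H : s ^+ m <= 1 + s ^+ (4 * m).
  have [s1|/ltW s1] := leP s 1.
    by apply: (@le_trans _ _ 1); [rewrite exprn_ile1// ltW|rewrite lerDl exprn_ge0// ltW].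
  apply: (@le_trans _ _ (s ^+ (4 * m))); last by rewrite lerDr.
  by apply: ler_weXn2l => //; rewrite leq_pmull.
have q0 : 0 <= s ^+ 4 / 2 by rewrite divr_ge0// exprn_ge0// ltW.
have H2 := exprn_le_expR m q0.
have Ee : expR (s ^+ 4 / 2) * e = 1 by rewrite -expRD subrr expR0.
have H3 : s ^+ (4 * m) * e <= m`!%:R * 2 ^+ m.
  have -> : s ^+ (4 * m) = 2 ^+ m * (s ^+ 4 / 2) ^+ m.
    by rewrite -exprMn mulrCA divff ?mulr1// -exprM.
  rewrite -mulrA mulrC ler_pM2r ?exprn_gt0//.
  apply: le_trans (ler_wpM2r (ltW e0) H2) _.
  by rewrite -mulrA Ee mulr1.
apply: le_trans (ler_wpM2r (ltW e0) H) _.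
by rewrite mulrDl mul1r lerD.
Qed.

(** With s = sqrt r, |ln(r^2)| = 4 |ln s| and |ln s|^i <= i! exp|ln s| <= i! (s + 1/s). Multiplying
    by the denominator of [sqrt_dominator] leaves (s^2 + 1)(1 + s)^2 <= 4 (1 + s^4), and the
    exponential absorbs the powers 2n and 2n + 4 of s. *)
Lemma log_power_dominated (n i : nat) :
  exists2 C : R, 0 <= C & forall r, 0 < r ->
    `|log_power n i r| <= C * sqrt_dominator r.
Proof.
pose c m : R := 1 + m`!%:R * 2 ^+ m.
have c0 m : 0 <= c m by rewrite addr_ge0// mulr_ge0// exprn_ge0.
exists (i`!%:R * 4 ^+ i * (4 * (c (2 * n)%N + c (2 * n + 4)%N))).
  by rewrite !mulr_ge0 ?exprn_ge0 ?addr_ge0.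
move=> r r0; rewrite /sqrt_dominator; set s := Num.sqrt r.
have s0 : 0 < s by rewrite sqrtr_gt0.
have rs : r = s ^+ 2 by rewrite sqr_sqrtr// ltW.
have D0 : 0 < s * (1 + s) ^+ 2 by rewrite mulr_gt0// exprn_gt0// addr_gt0.
rewrite ler_pdivlMr//.
have E0 := expR_gt0 (- (s ^+ 4 / 2)).
have -> : `|log_power n i r| =
    `|ln (r ^+ 2)| ^+ i * (s ^+ (2 * n) * expR (- (s ^+ 4 / 2))).
  rewrite /log_power normrM normrX; congr (_ * _).
  rewrite ger0_norm; last by rewrite mulr_ge0 ?expR_ge0// exprn_ge0// ltW.
  by rewrite rs -!exprM.
have Hln : `|ln (r ^+ 2)| ^+ i <= i`!%:R * 4 ^+ i * (s + s^-1).
  have -> : ln (r ^+ 2) = 4 * ln s by rewrite rs -exprM lnXn// mulr_natl.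
  rewrite normrM ger0_norm// exprMn [_ * 4 ^+ i]mulrC -mulrA.
  rewrite ler_pM2l ?exprn_gt0//.
  apply: le_trans (exprn_le_expR i (normr_ge0 _)) _.
  rewrite ler_wpM2l//; have [l0|l0] := leP 0 (ln s).
    by rewrite (ger0_norm l0) lnK ?posrE// lerDl invr_ge0 ltW.
  by rewrite (ltr0_norm l0) expRN lnK ?posrE// lerDr ltW.
have H1 := exprn_quartic_bound (2 * n) s0; have H2 := exprn_quartic_bound (2 * n + 4) s0.
set e := expR _ in E0 H1 H2 *.
have P0 : 0 <= s ^+ (2 * n) * e by rewrite mulr_ge0 ?exprn_ge0 ?ltW.
rewrite mulrAC; set Q := s ^+ (2 * n) * e in P0 H1 *.
have H2' : Q * s ^+ 4 <= c (2 * n + 4)%N by rewrite /Q mulrAC -exprD.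
apply: (@le_trans _ _ (i`!%:R * 4 ^+ i * (s + s^-1) * (s * (1 + s) ^+ 2) * Q)).
  by rewrite ler_wpM2r// ler_wpM2r// ltW.
rewrite -!mulrA ler_wpM2l// ler_wpM2l ?exprn_ge0//.
apply: (@le_trans _ _ ((s ^+ 2 + 1) * (1 + s) ^+ 2 * Q)).
  by rewrite le_eqVlt; apply/orP; left; apply/eqP; field; rewrite gt_eqF.
apply: (@le_trans _ _ (4 * (Q + Q * s ^+ 4))).
  have : (s ^+ 2 + 1) * (1 + s) ^+ 2 <= 4 * (1 + s ^+ 4).
    have h1 : (1 + s) ^+ 2 <= 2 * (s ^+ 2 + 1) by have := sqr_ge0 (s - 1); lra.
    have h2 : (s ^+ 2 + 1) * (2 * (s ^+ 2 + 1)) <= 4 * (1 + s ^+ 4).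
      by have := sqr_ge0 (s ^+ 2 - 1); nra.
    by apply: le_trans h2; rewrite ler_wpM2l// addr_ge0// sqr_ge0.
  by move=> /(ler_wpM2r P0); congr (_ <= _); ring.
by rewrite ler_wpM2l// lerD.
Qed.

Lemma sqrt_dominator_ge0 (r : R) : 0 <= sqrt_dominator r.
Proof. by rewrite invr_ge0 mulr_ge0 ?sqrtr_ge0 ?sqr_ge0. Qed.

Lemma is_derive_sqrt_dominator (r : R) : 0 < r ->
  is_derive r 1 (fun x => 2 - 2 * (1 + Num.sqrt x)^-1) (sqrt_dominator r).
Proof.
move=> r0; set s := Num.sqrt r.
have s0 : 0 < s by rewrite sqrtr_gt0.
have d1 : is_derive r 1 (fun x : R => 1 + Num.sqrt x) (2 * s)^-1.
  apply: is_derive_eq; first by apply: is_deriveD; exact: is_derive1_sqrt.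
  by rewrite add0r.
have n0 : 1 + Num.sqrt r != 0 by rewrite gt_eqF// addr_gt0.
have d2 := @is_deriveV _ (fun x : R => 1 + Num.sqrt x) r _ _ n0 d1.
apply: (is_derive_eq (is_deriveB (is_derive_cst (2 : R) r (1 : R))
  (is_deriveM (is_derive_cst (2 : R) r (1 : R)) d2))).
rewrite /sqrt_dominator -/s; rewrite -/s in n0.
rewrite sub0r scaler0 addr0 /GRing.scale /=.
have sn0 : s != 0 by rewrite gt_eqF.
by clearbody s; field; rewrite sn0 n0.
Qed.

Lemma continuous_sqrt_dominator (r : R) : 0 < r -> {for r, continuous sqrt_dominator}.
Proof.
move=> r0; have s0 : 0 < Num.sqrt r by rewrite sqrtr_gt0.
apply: cvgV; first by rewrite gt_eqF// mulr_gt0// exprn_gt0// addr_gt0.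
apply: cvgM; first exact: sqrt_continuous.
apply: (@continuous_comp _ _ _ (fun x : R => 1 + Num.sqrt x) (fun x : R => x ^+ 2)).
  by apply: cvgD; [exact: cvg_cst|exact: sqrt_continuous].
exact: sqr_continuous.
Qed.

(** The integration by parts behind [log_moment_rec]. At i = 0 the default index [i.-1] is
    multiplied by 0. *)
Lemma is_derive_log_power (n i : nat) (r : R) : 0 < r ->
  is_derive r 1 (log_power n.+1 i)
   (n.+1%:R * log_power n i r + 2 * i%:R * log_power n i.-1 r - log_power n.+2 i r).
Proof.
move=> r0; have rn0 : r != 0 by rewrite gt_eqF.
have dX (m : nat) : is_derive r 1 (fun x : R => x ^+ m) (m%:R * r ^+ m.-1).
  have := @is_deriveX R R id m r 1 1 (is_derive_id r 1).
  by rewrite exprfctE /GRing.scale /= mulr1.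
have dl : is_derive r 1 (fun x : R => ln (x ^+ 2)) (2 / r).
  apply: is_derive_eq.
    apply: (@is_derive1_comp _ (@ln R) (fun x : R => x ^+ 2)).
    by apply: is_derive1_ln; rewrite exprn_gt0.
  by rewrite expr1; field.
have dli : is_derive r 1 (fun x : R => ln (x ^+ 2) ^+ i)
    (i%:R * ln (r ^+ 2) ^+ i.-1 * (2 / r)).
  by have := is_deriveX i dl; rewrite exprfctE.
have de : is_derive r 1 (fun x : R => expR (- (x ^+ 2 / 2))) (expR (- (r ^+ 2 / 2)) * - r).
  apply: (@is_derive1_comp _ (@expR R) (fun x : R => - (x ^+ 2 / 2))).
  apply: is_derive_eq.
  by rewrite /GRing.scale /= expr1; field.
apply: (is_derive_eq (is_deriveM dli (is_deriveM (dX n.+1) de))).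
rewrite /GRing.scale /= /log_power.
rewrite [X in _ + X * _ = _](_ : _ = r ^+ n.+1 * expR (- (r ^+ 2 / 2)))//.
have -> : r ^+ n.+2 = r * r * r ^+ n by rewrite !exprS mulrA.
rewrite (exprS r n).
by field.
Qed.

Lemma continuous_log_power (n i : nat) (r : R) : 0 < r ->
  {for r, continuous (log_power n i)}.
Proof.
move=> r0.
have r2 : 0 < r ^+ 2 by rewrite exprn_gt0.
apply: cvgM.
  apply: (@continuous_comp _ _ _ (fun x : R => ln (x ^+ 2)) (fun x : R => x ^+ i)).
    apply: (@continuous_comp _ _ _ (fun x : R => x ^+ 2) (@ln R)).
      exact: sqr_continuous.
    exact: continuous_ln.
  exact: exprn_continuous.
apply: cvgM; first exact: exprn_continuous.
apply: (@continuous_comp _ _ _ (fun x : R => - (x ^+ 2 / 2)) (@expR R)).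
  apply: cvgN; apply: cvgM; last exact: cvg_cst.
  exact: sqr_continuous.
exact: continuous_expR.
Qed.

Lemma integrable_sqrt_dominator : mu.-integrable half (EFin \o sqrt_dominator).
Proof.
apply/integrableP; split.
  have : measurable_fun half (EFin \o sqrt_dominator).
    by apply/measurable_EFinP; apply: measurable_half => r; exact: continuous_sqrt_dominator.
  by [].
under eq_integral do rewrite /= ger0_norm ?sqrt_dominator_ge0//.
apply: (@le_lt_trans _ _ 2%:E); last exact: ltry.
apply: (ge0_integral_half_le is_derive_sqrt_dominator continuous_sqrt_dominator).
  by move=> r _; exact: sqrt_dominator_ge0.
move=> r r0; have s0 : 0 <= Num.sqrt r by exact: sqrtr_ge0.
have h1 : 0 <= (1 + Num.sqrt r)^-1 by rewrite invr_ge0 addr_ge0.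
have h2 : (1 + Num.sqrt r)^-1 <= 1 by rewrite invf_le1 ?lerDl// ltr_pwDl.
by apply/andP; split; lra.
Qed.

Lemma integrable_log_power (n i : nat) : mu.-integrable half (EFin \o log_power n i).
Proof.
have [C C0 HC] := log_power_dominated n i.
apply: (@le_integrable _ _ _ mu half _ _ (fun r => C%:E * (EFin \o sqrt_dominator) r)%E) => //.
- have : measurable_fun half (EFin \o log_power n i).
    by apply/measurable_EFinP; apply: measurable_half => r; exact: continuous_log_power.
  by [].
- move=> r /=; rewrite in_itv /= andbT => r0; rewrite lee_fin.
  apply: le_trans (HC r r0) _; apply: ler_norm.
- by apply: integrableZl => //; exact: integrable_sqrt_dominator.
Qed.

(** Raising [n] by one multiplies by r, so the dominator gives C s / (1 + s)^2 with s = sqrt r, at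
    most C s and at most C / s. Both ends reduce to the same sequence tending to 0. *)
Lemma log_power_boundary (n i : nat) :
  log_power n.+1 i k.+2%:R @[k --> \oo] --> (0 : R) /\
  log_power n.+1 i k.+2%:R^-1 @[k --> \oo] --> (0 : R).
Proof.
have [C C0 HC] := log_power_dominated n i.
have H r : 0 < r -> `|log_power n.+1 i r| <= C * Num.sqrt r /\
                    `|log_power n.+1 i r| <= C * (Num.sqrt r)^-1.
  move=> r0; set s := Num.sqrt r.
  have s0 : 0 < s by rewrite sqrtr_gt0.
  have rs : r = s ^+ 2 by rewrite sqr_sqrtr// ltW.
  have E : log_power n.+1 i r = r * log_power n i r.
    by rewrite /log_power (exprS r n); ring.
  have B : `|log_power n.+1 i r| <= C * (s / (1 + s) ^+ 2).
    rewrite E normrM (gtr0_norm r0) mulrC.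
    apply: le_trans (ler_wpM2r (ltW r0) (HC r r0)) _.
    rewrite -mulrA ler_wpM2l// /sqrt_dominator -/s [X in _ * X]rs le_eqVlt; apply/orP; left.
    have sn0 : s != 0 by rewrite gt_eqF.
    have n0 : 1 + s != 0 by rewrite gt_eqF// addr_gt0.
    by apply/eqP; clearbody s; field; rewrite sn0 n0.
  have p0 : 0 < (1 + s) ^+ 2 by rewrite exprn_gt0// addr_gt0.
  split; apply: (le_trans B); rewrite ler_wpM2l//.
    by rewrite ler_pdivrMr// ler_peMr ?ltW//; nra.
  rewrite ler_pdivrMr// mulrC ler_pdivlMr//; nra.
have sc : C * Num.sqrt k.+2%:R^-1 @[k --> \oo] --> (0 : R).
  have cvg_nS : n.+1 @[n --> \oo] --> \oo.
    by move=> A [N _ HN]; exists N => // m /= Nm; apply: HN; exact: leqW.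
  have hk : (k.+2%:R^-1 : R) @[k --> \oo] --> (0 : R).
    exact: (cvg_comp _ _ cvg_nS (@cvg_harmonic R)).
  rewrite -(mulr0 C); apply: cvgMl_tmp; rewrite -(@sqrtr0 R).
  exact: (cvg_comp _ _ hk (@sqrt_continuous R 0)).
split; apply/norm_cvg0P; apply: (squeeze_cvgr _ (@cvg_cst _ _ _ _ _) sc).
- apply: nearW => k; rewrite normr_ge0 /=.
  have [_] := H k.+2%:R (ltr0Sn _ _); rewrite sqrtrV ?ler0n//.
- apply: nearW => k; rewrite normr_ge0 /=.
  by have [] := H k.+2%:R^-1 _; rewrite ?invr_gt0 ?ltr0n.
Qed.

Definition log_moment (n i : nat) : R := fine (\int[mu]_(r in half) (log_power n i r)%:E)%E.

Lemma log_momentE n i :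
  (\int[mu]_(r in half) (log_power n i r)%:E = (log_moment n i)%:E)%E.
Proof.
rewrite /log_moment fineK//; apply: integrable_fin_num => //.
exact: integrable_log_power.
Qed.

Lemma log_moment_rec n i : log_moment n.+2 i =
  n.+1%:R * log_moment n i + 2 * i%:R * log_moment n i.-1.
Proof.
have [b1 b2] := log_power_boundary n i.
have iZ (c : R) m j : mu.-integrable half (fun r => (c%:E * (log_power m j r)%:E)%E).
  by apply: integrableZl => //; exact: integrable_log_power.
pose f r := n.+1%:R * log_power n i r + 2 * i%:R * log_power n i.-1 r - log_power n.+2 i r.
have cf r : 0 < r -> {for r, continuous f}.
  move=> r0; apply: cvgB; last exact: continuous_log_power.
  by apply: cvgD; (apply: cvgM; [exact: cvg_cst|exact: continuous_log_power]).
have fE r : (f r)%:E = (n.+1%:R%:E * (log_power n i r)%:E +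
    (2 * i%:R)%:E * (log_power n i.-1 r)%:E + (-1)%:E * (log_power n.+2 i r)%:E)%E.
  by rewrite -!EFinM -!EFinD mulN1r.
have If : mu.-integrable half (EFin \o f).
  have -> : EFin \o f = (fun r => n.+1%:R%:E * (log_power n i r)%:E +
    (2 * i%:R)%:E * (log_power n i.-1 r)%:E + (-1)%:E * (log_power n.+2 i r)%:E)%E.
    by apply/funext => r; exact: fE.
  by apply: integrableD => //; apply: integrableD.
have := integral_half_eq0 (@is_derive_log_power n i) cf If b1 b2.
under eq_integral do rewrite fE.
rewrite integralD//; last exact: integrableD.
rewrite integralD// !integralZl//; try exact: integrable_log_power.
rewrite !log_momentE -!EFinM -!EFinD mulN1r => -[/eqP].
by rewrite subr_eq0 => /eqP ->.
Qed.

Lemma log_moment0_gt0 n : 0 < log_moment n 0.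
Proof.
rewrite -lte_fin -log_momentE.
have m12 : measurable (`[1%R, 2%R]%classic : set R) by exact: measurable_itv.
have s12 : `[1%R, 2%R]%classic `<=` half.
  by move=> r /=; rewrite !in_itv /= andbT => /andP[r1 _]; exact: lt_le_trans r1.
have mf : measurable_fun half (fun r => (log_power n 0 r)%:E).
  by have /integrableP[] := integrable_log_power n 0.
have f0 r : 0 < r -> 0 <= log_power n 0 r.
  by move=> r0; rewrite /log_power expr0 mul1r mulr_ge0 ?expR_ge0 ?exprn_ge0 ?ltW.
(* On [1, 2] one has r^n >= 1 and r^2 / 2 <= 2. *)
apply: (@lt_le_trans _ _ (\int[mu]_(r in `[1%R, 2%R]) (expR (- 2))%:E)%E).
  rewrite integral_cst// [X in (_ * X)%E](_ : _ = 1%E).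
    by rewrite mule1 lte_fin expR_gt0.
  by have := @lebesgue_measure_itv R `[1, 2]; rewrite /= lte_fin ltr1n -EFinB addrK.
apply: (@le_trans _ _ (\int[mu]_(r in `[1%R, 2%R]) (log_power n 0 r)%:E)%E).
  apply: ge0_le_integral => //.
    exact: measurable_funS mf.
  move=> r /=; rewrite in_itv /= => /andP[r1 r2].
  rewrite lee_fin /log_power expr0 mul1r.
  have h1 : 1 <= r ^+ n by rewrite exprn_ege1.
  have h2 : expR (- 2) <= expR (- (r ^+ 2 / 2)).
    by rewrite ler_expR lerN2; nra.
  by rewrite -[leLHS]mul1r; apply: ler_pM => //; exact: expR_ge0.
apply: ge0_subset_integral => //.
by move=> r /=; rewrite in_itv /= andbT => r0; rewrite lee_fin f0.
Qed.

End log_power_kernel.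

Section chi_square_half_line.
Context {R : realType}.
Local Notation mu := (@lebesgue_measure R).
Local Notation half := (`]0%R, +oo[%classic : set R).

Lemma ge0_integral_even (G : R -> \bar R) : measurable_fun setT G ->
  (forall x, 0 <= G x)%E -> (forall x, G (- x)%R = G x) ->
  (\int[@leb R]_x G x = 2%:E * \int[mu]_(x in half) G x)%E.
Proof.
move=> mG G0 GN; rewrite ge0_integral_leb//.
have mS (S : set R) : measurable_fun S G by exact: measurable_funS mG.
have mh : measurable half by exact: measurable_itv.
rewrite -(setUv half) ge0_integral_setU//=; last 3 first.
- exact: measurableC.
- exact: mS.
- by apply/disj_setPS => x [].
have -> : ~` half = `]-oo, 0%R]%classic by rewrite setCitvr.
have -> : (\int[mu]_(x in `]-oo, 0%R]) G x = \int[mu]_(x in `]-oo, 0%R]) G (- x)%R)%E.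
  by apply: eq_integral => x _; rewrite GN.
rewrite -ge0_integration_by_substitution0// -integral_itv_obnd_cbnd//.
by rewrite [in RHS](_ : 2 = 1 + 1)// EFinD ge0_muleDl// mul1e.
Qed.

Lemma log_power_chi_kernel (n i : nat) (r : R) : half r ->
  log_power n i r = ln (r ^+ 2) ^+ i * chi_kernel n r.
Proof. by rewrite /= in_itv /= andbT => r0; rewrite /chi_kernel gtr0_norm. Qed.

Lemma chi_kernelN (n : nat) (r : R) : chi_kernel n (- r) = chi_kernel n r.
Proof. by rewrite /chi_kernel normrN sqrrN. Qed.

Lemma integral_chi_kernel (n : nat) :
  (\int[@leb R]_r (chi_kernel n r)%:E = (2 * log_moment n 0)%:E)%E.
Proof.
rewrite ge0_integral_even.
- rewrite EFinM -log_momentE; congr (_ * _)%E.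
  by apply: eq_integral => r; rewrite inE => /log_power_chi_kernel ->; rewrite mul1r.
- by apply/measurable_EFinP; exact: measurable_chi_kernel.
- by move=> r; rewrite lee_fin chi_kernel_ge0.
- by move=> r; rewrite chi_kernelN.
Qed.

Context (d : measure_display) (T : measurableType d) (P : probability T R).
Context (n : nat) (X : 'I_n.+1 -> T -> R) (gX : gaussian_family P X).

Let S w := \sum_i X i w ^+ 2.

Lemma ge0_chi_square_expectation (f : R -> \bar R) :
  measurable_fun setT f -> (forall x, 0 <= f x)%E ->
  (\int[P]_w f (S w) =
   (log_moment n 0)^-1%:E * \int[mu]_(r in half) (f (r ^+ 2)%R * (chi_kernel n r)%:E))%E.
Proof.
move=> mf f0.
have J0 := @log_moment0_gt0 R n.
have J20 : 0 < 2 * log_moment n 0 :> R by rewrite mulr_gt0.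
rewrite (chi_square_density J20 (integral_chi_kernel n) gX)//.
rewrite ge0_integral_even.
- rewrite muleA -EFinM; congr (_%:E * _)%E.
  by rewrite invfM mulrAC mulVf ?mul1r.
- apply: emeasurable_funM; last first.
    by apply/measurable_EFinP; exact: measurable_chi_kernel.
  by apply: (measurableT_comp mf); exact: measurable_funX.
- by move=> r; rewrite mule_ge0// lee_fin chi_kernel_ge0.
- by move=> r; rewrite chi_kernelN sqrrN.
Qed.

Lemma measurable_sum_sqr : measurable_fun setT S.
Proof.
have mX := gX.1.
by apply: measurable_sum => i; apply: measurable_funX; exact: mX.
Qed.

(** The nonnegative case applied to the positive and negative parts of [g]; the kernel is
    nonnegative and moves inside the maxima. *)
Lemma chi_square_expectation (g : R -> R) : measurable_fun setT g ->
  mu.-integrable half (fun r => (g (r ^+ 2) * chi_kernel n r)%:E) ->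
  P.-integrable setT (fun w => (g (S w))%:E) /\
  (\int[P]_w (g (S w))%:E =
   (log_moment n 0)^-1%:E * \int[mu]_(r in half) (g (r ^+ 2) * chi_kernel n r)%:E)%E.
Proof.
move=> mg ig.
have J0 : 0 <= (log_moment n 0)^-1 :> R by rewrite invr_ge0 ltW// log_moment0_gt0.
have mgE : measurable_fun setT (EFin \o g) by apply/measurable_EFinP.
have mh : measurable half by exact: measurable_itv.
have iP : P.-integrable setT (fun w => (g (S w))%:E).
  apply/integrableP; split.
    by apply/measurable_EFinP; apply: (measurableT_comp mg); exact: measurable_sum_sqr.
  rewrite (ge0_chi_square_expectation (f := fun x => `|(g x)%:E|%E))//; last first.
    exact: measurableT_comp.
  rewrite lte_mul_pinfty//.
  have /integrableP[_] := ig; congr (_ < _)%E.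
  by apply: eq_integral => r _; rewrite /= normrM EFinM (ger0_norm (chi_kernel_ge0 _ _)).
split=> //.
rewrite [LHS]integralE [X in (_ * X)%E]integralE.
have mp := measurable_funepos mgE; have mn := measurable_funeneg mgE.
rewrite funepos.unlock in mp; rewrite funeneg.unlock in mn.
rewrite funepos.unlock funeneg.unlock.
have Hp := @ge0_chi_square_expectation (fun x => maxe (g x)%:E 0)%E mp _.
have Hn := @ge0_chi_square_expectation (fun x => maxe (- (g x)%:E) 0)%E mn _.
rewrite {}Hp ?{}Hn; try by move=> x; rewrite le_max lexx orbT.
have K0 r : (0 <= (chi_kernel n r)%:E :> \bar R)%E by rewrite lee_fin chi_kernel_ge0.
have Ep r : (maxe (g (r ^+ 2))%:E 0 * (chi_kernel n r)%:E =
             maxe (g (r ^+ 2) * chi_kernel n r)%:E 0)%E.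
  by rewrite maxe_pMl// mul0e.
have En r : (maxe (- (g (r ^+ 2))%:E) 0 * (chi_kernel n r)%:E =
             maxe (- (g (r ^+ 2) * chi_kernel n r)%:E) 0)%E.
  by rewrite maxe_pMl// mul0e -EFinN -EFinM mulNr.
have -> : (\int[mu]_(r in half) (maxe (g (r ^+ 2))%:E 0 * (chi_kernel n r)%:E) =
    \int[mu]_(r in half) maxe (g (r ^+ 2) * chi_kernel n r)%:E 0)%E.
  by apply: eq_integral => r _; exact: Ep.
have -> : (\int[mu]_(r in half) (maxe (- (g (r ^+ 2))%:E) 0 * (chi_kernel n r)%:E) =
    \int[mu]_(r in half) maxe (- (g (r ^+ 2) * chi_kernel n r)%:E) 0)%E.
  by apply: eq_integral => r _; exact: En.
have mh' : measurable (half : set (measurableTypeR R)) by exact: measurable_itv.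
have := integrable_add_def mh' ig.
rewrite funepos.unlock funeneg.unlock => H.
by symmetry; apply: muleBr H.
Qed.

End chi_square_half_line.

Section log_chi_square.
Context {R : realType}.

(* Index [n] stands for [n + 1] degrees of freedom. *)
Definition log_chi_coef (n i : nat) : R := log_moment n i / (log_moment n 0 * i`!%:R).

Lemma log_chi_square_has_moments (n : nat) :
  log_chi_square_moments n (log_chi_coef n).
Proof.
move=> d T P X gX; split.
  by apply: measurableT_comp => //; exact: measurable_sum_sqr gX.
move=> i.
have mg : measurable_fun setT (fun x : R => ln x ^+ i).
  by apply: measurable_funX; exact: measurable_ln.
have ig : (@lebesgue_measure R).-integrable `]0%R, +oo[%classic
    (fun r => (ln (r ^+ 2) ^+ i * chi_kernel n r)%:E).
  have := @integrable_log_power R n i; apply: eq_integrable => //.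
  by move=> r; rewrite inE /= => /(@log_power_chi_kernel R n i) ->.
have [h1 h2] := chi_square_expectation gX mg ig.
split=> //; rewrite h2.
under eq_integral => r rh.
  rewrite -log_power_chi_kernel; last by rewrite inE in rh.
  over.
rewrite log_momentE -EFinM; congr EFin; rewrite /log_chi_coef.
have := @log_moment0_gt0 R n; have := @fact_neq0 R i.
by move=> f0 J0; field; rewrite f0 gt_eqF.
Qed.

(** [log_moment_rec] divided by its own case i = 0, where the normalizing constants have ratio n +
    1: the generating function is multiplied by 1 + 2 t / (n + 1). *)
Lemma log_chi_coefSS (n : nat) :
  log_chi_coef n.+2 =1 cauchy_prod (log_chi_coef n)
    (fun i => if i == 0%N then 1 else if i == 1%N then 2 / n.+1%:R else 0).
Proof.
have J0 : log_moment n 0 != 0 :> R by rewrite gt_eqF// log_moment0_gt0.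
have m0 : n.+1%:R != 0 :> R by [].
have J2 : log_moment n.+2 0 = n.+1%:R * log_moment n 0 :> R.
  by rewrite log_moment_rec mulr0 mul0r addr0.
rewrite /log_chi_coef => -[|i].
  rewrite /cauchy_prod big_ord_recl big_ord0 /= J2 addr0 mulr1.
  by rewrite fact0 !mulr1 !divff// mulf_neq0.
rewrite /cauchy_prod !big_ord_recr /= big1 ?add0r; last first.
  move=> j _; have ji := ltn_ord j.
  by rewrite !ifF ?mulr0//; apply/eqP; lia.
rewrite subSnn subnn eqxx /= mulr1 J2 log_moment_rec factS natrM /=.
have f0 := @fact_neq0 R i; have i0 : i.+1%:R != 0 :> R by [].
move: (n.+1%:R) (i.+1%:R) m0 i0 => a b a0 b0.
by field; rewrite f0 b0 a0 J0.
Qed.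

Lemma log_chi_coef0 (n : nat) : log_chi_coef n 0 = 1.
Proof.
by rewrite /log_chi_coef fact0 mulr1 divff// gt_eqF// log_moment0_gt0.
Qed.

End log_chi_square.

(** Each term in the recursion for [K N] contains a moment of positive order, hence a factor [e];
    the accompanying [K j] is at most [D] because e <= 1. The constant serves all sequences at once,
    hence all degrees of freedom. *)
Lemma cumulants_small (R : realFieldType) (C : nat -> R) (N : nat) :
  (forall i, 0 <= C i) ->
  exists2 D : R, 0 <= D & forall (e : R) (K m : nat -> R), 0 <= e <= 1 ->
    (forall i, (0 < i)%N -> `|m i| <= C i * e) -> cumulants K m ->
    forall i, (i < N)%N -> `|K i| <= D * e.
Proof.
move=> C0; elim: N => [|N [D D0 HD]]; first by exists 0.
pose S := \sum_(j < N) C (N - j)%N.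
have S0 : 0 <= S by exact: sumr_ge0.
exists (D + N.+1%:R * C N.+1 + D * S); first by rewrite !addr_ge0// mulr_ge0.
move=> e K m /andP[e0 e1] Hm HK i; rewrite ltnS leq_eqVlt => /predU1P[->|iN]; last first.
  apply: (le_trans (HD e K m _ Hm HK i iN)); first by rewrite e0.
  by rewrite ler_wpM2r// -addrA lerDl addr_ge0// mulr_ge0.
have [m0 Km] := HK.
have -> : K N = N.+1%:R * m N.+1 - \sum_(j < N) K j * m (N - j)%N.
  by rewrite Km big_ord_recr /= subnn m0 mulr1 addrAC subrr add0r.
apply: le_trans (ler_normB _ _) _.
have h1 : `|N.+1%:R * m N.+1| <= N.+1%:R * C N.+1 * e.
  by rewrite normrM ger0_norm// -mulrA ler_wpM2l// Hm.
have h2 : `|\sum_(j < N) K j * m (N - j)%N| <= D * S * e.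
  apply: le_trans (ler_norm_sum _ _ _) _.
  rewrite /S mulr_sumr mulr_suml; apply: ler_sum => j _.
  have jN := ltn_ord j; rewrite normrM.
  have a1 : `|K j| <= D.
    apply: le_trans (HD e K m _ Hm HK j jN) _; first by rewrite e0.
    by rewrite ler_piMr.
  rewrite -mulrA; apply: ler_pM => //.
  by apply: Hm; rewrite subn_gt0.
apply: le_trans (lerD h1 h2) _.
have : 0 <= D * e by rewrite mulr_ge0.
by rewrite !mulrDl; lra.
Qed.

(** * Concentration of the logarithm of a chi-square variable *)

Section log_chi_square_centred.
Context {R : realType}.
Local Notation mu := (@lebesgue_measure R).
Local Notation half := (`]0%R, +oo[%classic : set R).

(* With [y = expR (2 u)] the right-hand side is the square of
   [expR u - expR (- u)], and [expR u - expR (- u) >= u ^+ i / i`!] for [u >= 0]. *)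
Lemma ln_even_power_bound (i : nat) (y : R) : (0 < i)%N -> 0 < y ->
  ln y ^+ (2 * i) <= 4 ^+ i * i`!%:R ^+ 2 * (y + y^-1 - 2).
Proof.
case: i => // i _ y0; set x := ln y; set u := `|x| / 2; set a := expR u.
have u0 : 0 <= u by rewrite divr_ge0.
have a0 : 0 < a by exact: expR_gt0.
have Ea : expR `|x| = a ^+ 2 by rewrite /a expr2 -expRD /u -splitr.
have Ey : y + y^-1 = a ^+ 2 + (a ^+ 2)^-1.
  rewrite -Ea; have [l0|l0] := leP 0 x.
    by rewrite (ger0_norm l0) lnK ?posrE.
  by rewrite (ltr0_norm l0) expRN lnK ?posrE// invrK addrC.
have Es : y + y^-1 - 2 = (a - a^-1) ^+ 2.
  by rewrite Ey; field; rewrite gt_eqF.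
have a1 : 1 <= a by rewrite /a -expR0 ler_expR.
have H : u ^+ i.+1 / i.+1`!%:R <= a - a^-1.
  have := expR_ge1Dxn i u0; have : a^-1 <= 1 by rewrite invf_le1.
  by rewrite -/a; lra.
have f0 : 0 < i.+1`!%:R :> R by rewrite ltr0n fact_gt0.
have q0 : 0 <= u ^+ i.+1 / i.+1`!%:R by rewrite divr_ge0 ?exprn_ge0// ltW.
have -> : x ^+ (2 * i.+1) = 4 ^+ i.+1 * i.+1`!%:R ^+ 2 * (u ^+ i.+1 / i.+1`!%:R) ^+ 2.
  have xu : `|x| = 2 * u by rewrite /u mulrC divfK.
  have -> : x ^+ (2 * i.+1) = 4 ^+ i.+1 * (u ^+ i.+1) ^+ 2.
    rewrite exprM -real_normK ?num_real// xu.
    by move: (u) => v; rewrite !exprMn mulrACA -exprMn -natrM -expr2.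
  by field; rewrite gt_eqF.
rewrite Es ler_wpM2l ?mulr_ge0 ?exprn_ge0//.
by rewrite lerXn2r ?nnegrE//; apply: le_trans H.
Qed.

Context (d : measure_display) (T : measurableType d) (P : probability T R).
Context (n : nat) (X : 'I_n.+3 -> T -> R) (gX : gaussian_family P X).

Let y w := - ln n.+3%:R + ln (\sum_i X i w ^+ 2).

(** For S chi-square with m = n + 3 degrees of freedom, E S = m and E(1/S) = 1 / (m - 2), so S/m +
    m/S - 2 has mean m / (m - 2) - 1 = 2 / (n + 1). Starting at three degrees of freedom keeps
    E(1/S) finite. *)
Lemma log_chi_square_even_moment (i : nat) : (0 < i)%N ->
  (\int[P]_w (y w ^+ (2 * i))%:E <=
   (4 ^+ i * i`!%:R ^+ 2 * (2 / n.+1%:R))%:E)%E.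
Proof.
move=> i0; set C := 4 ^+ i * _.
have C0 : 0 <= C by rewrite mulr_ge0 ?exprn_ge0.
pose f (x : R) := ((- ln n.+3%:R + ln x) ^+ (2 * i))%:E.
have mf : measurable_fun setT f.
  apply/measurable_EFinP; apply: measurable_funX; exact: measurable_funD.
have f0 x : (0 <= f x)%E by rewrite lee_fin exprM exprn_ge0// sqr_ge0.
rewrite (ge0_chi_square_expectation gX mf f0).
have J0 : 0 < log_moment n.+2 0 :> R := log_moment0_gt0 _.
rewrite muleC -lee_pdivlMr ?invr_gt0// invrK.
(* Multiplying the kernel by r^2 or r^-2 shifts its index n + 2 by 2 up or down. *)
pose g r : R := C * (n.+3%:R^-1 * log_power n.+4 0 r + n.+3%:R * log_power n 0 r
  - 2 * log_power n.+2 0 r).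
have iZ (c : R) m j : mu.-integrable half (fun r => (c%:E * (log_power m j r)%:E)%E).
  by apply: integrableZl => //; exact: integrable_log_power.
have gE r : (g r)%:E = (C%:E *
  (n.+3%:R^-1%:E * (log_power n.+4 0 r)%:E + n.+3%:R%:E * (log_power n 0 r)%:E
   + (- 2)%:E * (log_power n.+2 0 r)%:E))%E.
  have -> : ((n.+3%:R^-1%:E * (log_power n.+4 0 r)%:E + n.+3%:R%:E * (log_power n 0 r)%:E
     + (- 2)%:E * (log_power n.+2 0 r)%:E) = (n.+3%:R^-1 * log_power n.+4 0 r +
     n.+3%:R * log_power n 0 r - 2 * log_power n.+2 0 r)%:E)%E.
    by rewrite -!EFinM -!EFinD mulNr.
  by rewrite -EFinM.
have ih : mu.-integrable half (fun r =>
  (n.+3%:R^-1%:E * (log_power n.+4 0 r)%:E + n.+3%:R%:E * (log_power n 0 r)%:E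
   + (- 2)%:E * (log_power n.+2 0 r)%:E))%E.
  by apply: integrableD => //; apply: integrableD.
have ig : mu.-integrable half (fun r => (g r)%:E).
  by rewrite (funext gE); apply: integrableZl.
apply: (@le_trans _ _ (\int[mu]_(r in half) (g r)%:E)%E).
  apply: ge0_le_integral => //.
  - move=> r; rewrite /= in_itv /= andbT => r0.
    by rewrite mule_ge0// lee_fin chi_kernel_ge0.
  - have mk : measurable_fun half (fun r : R => f (r ^+ 2)%R * (chi_kernel n.+2 r)%:E)%E.
      apply: (@measurable_funS _ _ _ _ setT) => //; apply: emeasurable_funM.
        by apply: (measurableT_comp mf); exact: measurable_funX.
      by apply/measurable_EFinP; exact: measurable_chi_kernel.
    exact: mk.
  - by have /integrableP[] := ig.
  move=> r; rewrite /= in_itv /= andbT => r0.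
  rewrite -EFinM lee_fin.
  have m0 : 0 < n.+3%:R :> R by [].
  have q0 : 0 < r ^+ 2 / n.+3%:R by rewrite divr_gt0// exprn_gt0.
  have -> : - ln n.+3%:R + ln (r ^+ 2) = ln (r ^+ 2 / n.+3%:R).
    by rewrite addrC ln_div ?posrE// exprn_gt0.
  apply: le_trans (ler_wpM2r (chi_kernel_ge0 _ _) (ln_even_power_bound i0 q0)) _.
  rewrite -/C /g /log_power /chi_kernel (gtr0_norm r0) !expr0 !mul1r.
  rewrite le_eqVlt; apply/orP; left; apply/eqP.
  rewrite !(exprS _ n.+3) !(exprS _ n.+2) !(exprS _ n.+1) !(exprS _ n).
  move: (n.+3%:R) m0 (expR _) => a a0 e.
  by field; rewrite !gt_eqF.
under eq_integral do rewrite gE.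
rewrite integralZl// integralD//; last exact: integrableD.
rewrite integralD// !integralZl//; try exact: integrable_log_power.
rewrite !log_momentE.
have -> : (n.+3%:R^-1%:E * (log_moment n.+4 0)%:E + n.+3%:R%:E * (log_moment n 0)%:E
     + (- 2)%:E * (log_moment n.+2 0)%:E = (n.+3%:R^-1 * log_moment n.+4 0 +
     n.+3%:R * log_moment n 0 - 2 * log_moment n.+2 0)%:E :> \bar R)%E.
  by rewrite -!EFinM -!EFinD mulNr.
rewrite -!EFinM lee_fin le_eqVlt; apply/orP; left; apply/eqP.
have J4 : log_moment n.+4 0 = n.+3%:R * log_moment n.+2 0 :> R.
  by rewrite log_moment_rec mulr0 mul0r addr0.
have J2 : log_moment n.+2 0 = n.+1%:R * log_moment n 0 :> R.
  by rewrite log_moment_rec mulr0 mul0r addr0.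
rewrite J4 J2.
have -> : n.+3%:R = n.+1%:R + 2 :> R by rewrite -natrD addn2.
have a0 : 0 < n.+1%:R :> R by [].
move: (n.+1%:R) a0 => a a0.
by field; rewrite !gt_eqF// addr_gt0.
Qed.

(** By 2 |y^i| <= 1/s + s y^(2i). The weight s = sqrt(n + 1) balances the two terms, as the even
    moment is O(1/s^2). *)
Lemma log_chi_square_abs_moment (i : nat) : (0 < i)%N ->
  (\int[P]_w `|y w ^+ i|%:E <=
   ((1 + 4 ^+ i * i`!%:R ^+ 2 * 2) * (Num.sqrt n.+1%:R)^-1)%:E)%E.
Proof.
move=> i0; set s := Num.sqrt _; set C := 4 ^+ i * _.
have s0 : 0 < s by rewrite sqrtr_gt0.
have ss : s ^+ 2 = n.+1%:R by rewrite sqr_sqrtr.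
have my : measurable_fun setT y.
  apply: measurable_funD => //; apply: measurableT_comp; first exact: measurable_ln.
  exact: measurable_sum_sqr gX.
have my2 : measurable_fun setT (fun w => (y w ^+ (2 * i))%:E).
  by apply/measurable_EFinP; exact: measurable_funX.
have y20 w : (0 <= (y w ^+ (2 * i))%:E)%E by rewrite lee_fin exprM exprn_ge0// sqr_ge0.
apply: (@le_trans _ _ (\int[P]_w (s^-1%:E + s%:E * (y w ^+ (2 * i))%:E))%E).
  apply: ge0_le_integral => //.
  - by apply/measurable_EFinP; apply: measurableT_comp => //; exact: measurable_funX.
  - by apply: emeasurable_funD => //; exact: measurable_funeM.
  move=> w _; rewrite -EFinM -EFinD lee_fin mulnC exprM -real_normK ?num_real//.
  set a := `|_|.
  have a0 : 0 <= a by exact: normr_ge0.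
  have : 0 <= (s * a - 1) ^+ 2 / s by rewrite divr_ge0 ?sqr_ge0 ?ltW.
  have -> : (s * a - 1) ^+ 2 / s = s * a ^+ 2 + s^-1 - 2 * a by field; rewrite gt_eqF.
  lra.
rewrite ge0_integralD//; last 3 first.
- by move=> w _; rewrite lee_fin invr_ge0 ltW.
- by move=> w _; rewrite mule_ge0// lee_fin ltW.
- exact: measurable_funeM.
rewrite [X in (X + _)%E](_ : _ = s^-1%:E); last first.
  apply: etrans (integral_cst P measurableT (s^-1)%:E) _.
  by rewrite [X in (_ * X)%E](_ : _ = 1%E) ?mule1//; exact: probability_setT.
rewrite ge0_integralZl//; last by rewrite lee_fin ltW.
apply: (@le_trans _ _ (s^-1%:E + s%:E * (C * (2 / n.+1%:R))%:E)%E).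
  rewrite leeD2l//; apply: lee_wpmul2l; first by rewrite lee_fin ltW.
  exact: log_chi_square_even_moment.
rewrite -EFinM -EFinD lee_fin le_eqVlt -ss; apply/orP; left; apply/eqP.
by field; rewrite gt_eqF.
Qed.

Lemma log_chi_square_centred_coef (i : nat) : (0 < i)%N ->
  `|cauchy_prod (exp_coef (- ln n.+3%:R)) (log_chi_coef n.+2) i : R| <=
  (1 + 4 ^+ i * i`!%:R ^+ 2 * 2) * (Num.sqrt n.+1%:R)^-1.
Proof.
move=> i0.
have [_ /(_ i)[iy Ey]] := has_moments_shift (- ln n.+3%:R) (log_chi_square_has_moments gX).
set c := cauchy_prod _ _ i in Ey *.
apply: (@le_trans _ _ (i`!%:R * `|c|)).
  by rewrite ler_peMl// ler1n fact_gt0.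
rewrite -lee_fin; apply: le_trans (log_chi_square_abs_moment i0).
rewrite -(@ger0_norm R i`!%:R)// -normrM.
have -> : (`|i`!%:R * c|%:E = `|\int[P]_w (y w ^+ i)%:E|)%E by rewrite /y Ey.
apply: le_trans (le_abse_integral _ _ _) _ => //.
by have /integrableP[] := iy.
Qed.

End log_chi_square_centred.

(** * Cumulants of the logarithm of a chi-square variable *)

Section log_chi_square_cumulants.
Context {R : realType}.

Definition log_chi_cumulant (n : nat) : nat -> R :=
  sval (cid (cumulants_exists (log_chi_coef0 n))).

Local Notation kappa := log_chi_cumulant.

Lemma log_chi_cumulantP (n : nat) : cumulants (kappa n) (log_chi_coef n).
Proof. exact: svalP (cid (cumulants_exists (log_chi_coef0 n))). Qed.

Lemma log_chi_cumulantSS (n j : nat) :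
  kappa n.+2 j = kappa n j + (-1) ^+ j * (2 / n.+1%:R) ^+ j.+1.
Proof.
have H := cumulantsD (log_chi_cumulantP n) (cumulants_one_plus (2 / n.+1%:R)).
have H2 := eq_cumulants (frefl _) (fsym (log_chi_coefSS n)) H.
exact: (cumulants_unique (log_chi_cumulantP n.+2) H2 j).
Qed.

(** The centred moments of log chi^2 are estimated as expectations, so some probability space must
    carry the normal variables; the matrices of the theorem supply it. *)
Definition gaussian_families_exist : Prop :=
  forall n, exists (d : measure_display) (T : measurableType d)
    (P : probability T R) (X : 'I_n.+1 -> T -> R), gaussian_family P X.

(** Subtracting ln(n + 3) changes only the cumulant of index 0, so for j > 0 the bounds on the
    centred moments apply through [cumulants_small]. *)
Lemma cvg_log_chi_cumulant (j : nat) : gaussian_families_exist -> (0 < j)%N ->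
  kappa n j @[n --> \oo] --> (0 : R).
Proof.
move=> Hex j0.
pose C i : R := 1 + 4 ^+ i * i`!%:R ^+ 2 * 2.
have C0 i : 0 <= C i by rewrite /C addr_ge0// !mulr_ge0 ?exprn_ge0.
have [D D0 HD] := cumulants_small j.+1 C0.
have B n : `|kappa n.+2 j| <= D * (Num.sqrt n.+1%:R)^-1.
  have [d [T [P [X gX]]]] := Hex n.+2.
  pose K i : R := (if i == 0%N then - ln n.+3%:R else 0) + kappa n.+2 i.
  have -> : kappa n.+2 j = K j by rewrite /K gtn_eqF// add0r.
  apply: HD => //.
  - by rewrite invr_ge0 sqrtr_ge0 invf_le1 ?sqrtr_gt0// -[leLHS]sqrtr1 ler_sqrt// ler1n.
  - by move=> i i0; apply: (log_chi_square_centred_coef gX i0).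
  - exact: cumulantsD (cumulants_exp _) (log_chi_cumulantP _).
have s0 : (Num.sqrt n.+1%:R)^-1 @[n --> \oo] --> (0 : R).
  have := cvg_comp _ _ (@cvg_harmonic R) (@sqrt_continuous R 0).
  rewrite sqrtr0; apply: cvg_trans; apply: near_eq_cvg; apply: nearW => n /=.
  by rewrite sqrtrV.
have sD : D * (Num.sqrt n.+1%:R)^-1 @[n --> \oo] --> (0 : R).
  by rewrite -(mulr0 D); apply: cvgMl_tmp.
have H : kappa n.+2 j @[n --> \oo] --> (0 : R).
  apply/norm_cvg0P; apply: (squeeze_cvgr _ (@cvg_cst _ _ _ _ _) sD).
  by apply: nearW => n; rewrite normr_ge0 B.
rewrite -(cvg_shiftn 2 (fun n => kappa n j : R)).
by apply: cvg_trans H; apply: near_eq_cvg; apply: nearW => n /=; rewrite addn2.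
Qed.

(** From a to a + 2 the majorant drops by at least the change of the cumulant. All cases reduce to j
    = 1, where the slack is a positive multiple of a - 1; there 3 is the least constant that works
    at a = 1, one degree of freedom. *)
Lemma ler_inverse_power_step (a : R) (j : nat) : 1 <= a -> (0 < j)%N ->
  3 * 2 ^+ j / (a + 2) ^+ j + (2 / a) ^+ j.+1 <= 3 * 2 ^+ j / a ^+ j.
Proof.
case: j => // i a1 _; have a0 : 0 < a by exact: lt_le_trans a1.
have b0 : 0 < a + 2 by rewrite addr_gt0.
have ai0 : 0 < a ^+ i by rewrite exprn_gt0.
have h1 : ((a + 2) ^+ i.+1)^-1 <= (a ^+ i * (a + 2))^-1.
  rewrite lef_pV2 ?posrE ?mulr_gt0 ?exprn_gt0// exprSr ler_pM2r//.
  by rewrite lerXn2r ?nnegrE ?lerDl// ltW.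
have h2 : 3 / (a + 2) + 2 / a ^+ 2 <= 3 / a.
  have : 0 <= (4 * (a - 1)) / (a ^+ 2 * (a + 2)).
    apply: divr_ge0; first by rewrite mulr_ge0// subr_ge0.
    by rewrite mulr_ge0 ?sqr_ge0// ltW.
  have -> : 4 * (a - 1) / (a ^+ 2 * (a + 2)) = 3 / a - 3 / (a + 2) - 2 / a ^+ 2.
    by field; rewrite !gt_eqF.
  by lra.
have c0 : 0 < 2 ^+ i.+1 :> R by rewrite exprn_gt0.
apply: (@le_trans _ _ (2 ^+ i.+1 / a ^+ i * (3 / (a + 2) + 2 / a ^+ 2))).
  have -> : 2 ^+ i.+1 / a ^+ i * (3 / (a + 2) + 2 / a ^+ 2) =
      3 * 2 ^+ i.+1 * (a ^+ i * (a + 2))^-1 + (2 / a) ^+ i.+2.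
    rewrite expr_div_n (exprS 2 i.+1) !(exprS a) .
    by field; rewrite !gt_eqF.
  by rewrite lerD2r ler_wpM2l// mulr_ge0// ltW.
have -> : 3 * 2 ^+ i.+1 / a ^+ i.+1 = 2 ^+ i.+1 / a ^+ i * (3 / a).
  by rewrite !(exprS a); field; rewrite !gt_eqF.
by rewrite ler_wpM2l// divr_ge0 ?ltW.
Qed.

Lemma cvg_inverse_power (c : R) (j : nat) : (0 < j)%N ->
  c / n.+1%:R ^+ j @[n --> \oo] --> (0 : R).
Proof.
move=> j0; rewrite -(mulr0 c); apply: cvgMl_tmp.
have := cvg_comp _ _ (@cvg_harmonic R) (@exprn_continuous R j 0).
rewrite expr0n gtn_eqF//; apply: cvg_trans; apply: near_eq_cvg; apply: nearW => n /=.
by rewrite exprVn.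
Qed.

(* The difference of the two sides tends to [0] and decreases along [n -> n + 2],
   hence is nonnegative. *)
Lemma log_chi_cumulant_le (n j : nat) : gaussian_families_exist -> (0 < j)%N ->
  `|kappa n j| <= 3 * 2 ^+ j / n.+1%:R ^+ j.
Proof.
move=> Hex j0.
have key (e : R) : `|e| = 1 -> e * kappa n j <= 3 * 2 ^+ j / n.+1%:R ^+ j.
  move=> e1; rewrite -subr_ge0.
  (* Here [m] counts degrees of freedom, hence the index m - 1 of the cumulant. *)
  pose f (m : nat) : R := 3 * 2 ^+ j / m%:R ^+ j - e * kappa m.-1 j.
  suff : forall m, (0 < m)%N -> 0 <= f m by move=> /(_ n.+1); exact.
  apply: step2_ge0.
    rewrite -(cvg_shiftn 1 f).
    have : 3 * 2 ^+ j / n.+1%:R ^+ j - e * kappa n j @[n --> \oo] --> (0 - e * 0 : R).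
      by apply: cvgB; [exact: cvg_inverse_power|apply: cvgMl_tmp; exact: cvg_log_chi_cumulant].
    rewrite mulr0 subr0; apply: cvg_trans; apply: near_eq_cvg; apply: nearW => m /=.
    by rewrite /f addn1.
  case=> // m _; rewrite /f /= log_chi_cumulantSS.
  have m1 : 1 <= m.+1%:R :> R by rewrite ler1n.
  have := ler_inverse_power_step m1 j0.
  have -> : m.+3%:R = m.+1%:R + 2 :> R by rewrite -natrD addn2.
  have : - (e * ((-1) ^+ j * (2 / m.+1%:R) ^+ j.+1)) <= (2 / m.+1%:R) ^+ j.+1.
    apply: le_trans (ler_norm _) _.
    by rewrite normrN !normrM e1 normrX normrN1 expr1n !mul1r normrX ger0_norm.
  by rewrite mulrDr; lra.
rewrite ler_norml lerNl; have := key 1; have := key (-1).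
rewrite normrN1 normr1 mulN1r mul1r => h1 h2; apply/andP; split.
  exact: h1.
exact: h2.
Qed.

(** The same descent: the excess over 2/m tends to 0 and loses 8 / (m^2 (m + 2)) from m to m + 2. *)
Lemma log_chi_cumulant1_ge (n : nat) : gaussian_families_exist ->
  2 / n.+1%:R <= kappa n 1.
Proof.
move=> Hex; rewrite -subr_ge0.
pose f (m : nat) : R := kappa m.-1 1 - 2 / m%:R.
suff : forall m, (0 < m)%N -> 0 <= f m by move=> /(_ n.+1); exact.
apply: step2_ge0.
  rewrite -(cvg_shiftn 1 f).
  have : kappa n 1 - 2 / n.+1%:R ^+ 1 @[n --> \oo] --> (0 - 0 : R).
    by apply: cvgB; [exact: cvg_log_chi_cumulant|exact: cvg_inverse_power].
  rewrite subr0; apply: cvg_trans; apply: near_eq_cvg; apply: nearW => m /=.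
  by rewrite /f addn1 expr1.
case=> // m _; rewrite /f /= log_chi_cumulantSS.
have m1 : 0 < m.+1%:R :> R by [].
have -> : m.+3%:R = m.+1%:R + 2 :> R by rewrite -natrD addn2.
move: (m.+1%:R) m1 => a a0.
have : 0 <= 8 / (a ^+ 2 * (a + 2)) by rewrite divr_ge0 ?mulr_ge0 ?sqr_ge0 ?addr_ge0 ?ltW.
have -> : 8 / (a ^+ 2 * (a + 2)) = (2 / a) ^+ 2 + 2 / (a + 2) - 2 / a.
  by field; rewrite !gt_eqF// addr_gt0.
by rewrite expr1 mulN1r; lra.
Qed.

End log_chi_square_cumulants.

(** * Moments of the log-determinant *)

Section gram_cumulants.
Context {R : realType}.
Local Notation kappa := (@log_chi_cumulant R).

Definition gram_cumulant (n p j : nat) : R := \sum_(n - p <= q < n) kappa q j.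

Lemma gram_cumulantP (n p : nat) : (p <= n)%N ->
  cumulants (gram_cumulant n p) (gram_log_moments log_chi_coef n p).
Proof.
elim: p n => [|p IH] n pn.
  apply: eq_cumulants (cumulants0 R) => [j|i]; last by case: n pn.
  by rewrite /gram_cumulant subn0 big_geq.
case: n pn => // n; rewrite ltnS => pn.
apply: eq_cumulants (cumulantsD (log_chi_cumulantP n) (IH n pn)) => // j.
by rewrite /gram_cumulant subSS big_nat_recr/= ?leq_subr// addrC.
Qed.

Lemma gram_cumulant1_ge (n p : nat) : gaussian_families_exist (R := R) ->
  2 * (\sum_(n - p <= q < n) q.+1%:R^-1) <= gram_cumulant n p 1.
Proof. by move=> Hex; rewrite mulr_sumr; apply: ler_sum => q _; exact: log_chi_cumulant1_ge. Qed.

(** Termwise, one factor 2 / (q + 1) of the cumulant bound is absorbed by the variance [kappa q 1],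
    and the remaining powers are largest at q = n - p. Measuring against the variance itself serves
    every growth of p at once. *)
Lemma gram_cumulant_le (n p i : nat) : gaussian_families_exist (R := R) ->
  `|gram_cumulant n p i.+1| <= 3 * 2 ^+ i / (n - p).+1%:R ^+ i * gram_cumulant n p 1.
Proof.
move=> Hex; apply: le_trans (ler_norm_sum _ _ _) _.
rewrite mulr_sumr; apply: ler_sum_nat => q /andP[pq _].
have a0 : 0 < (n - p).+1%:R :> R by [].
have q0 : 0 < q.+1%:R :> R by [].
have aq : (n - p).+1%:R <= q.+1%:R :> R by rewrite ler_nat.
apply: le_trans (log_chi_cumulant_le q Hex (ltn0Sn i)) _.
apply: (@le_trans _ _ (3 * 2 ^+ i / (n - p).+1%:R ^+ i * (2 / q.+1%:R))); last first.
  by rewrite ler_wpM2l ?log_chi_cumulant1_ge// divr_ge0 ?mulr_ge0 ?exprn_ge0// ltW.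
have -> : 3 * 2 ^+ i.+1 / q.+1%:R ^+ i.+1 = 3 * 2 ^+ i * (2 / q.+1%:R) * (q.+1%:R ^+ i)^-1 :> R.
  by rewrite !exprS; field; rewrite !gt_eqF// exprn_gt0.
rewrite [leRHS]mulrAC; apply: ler_wpM2l; first by rewrite !mulr_ge0 ?exprn_ge0 ?invr_ge0.
rewrite lef_pV2 ?posrE ?exprn_gt0//.
by rewrite lerXn2r ?nnegrE.
Qed.

Context (g : nat -> R) (hg : cumulants (fun j => (j == 1%N)%:R) g).

(** This is [moments_near_normal] with delta = 1 / (a sqrt V): the hypothesis 1 <= a^2 V says delta
    <= 1, and the quotient in the bound is delta^2. *)
Lemma gram_standardized_moment (k : nat) : ~~ odd k ->
  exists2 C : R, 0 <= C &
  forall (n p : nat) (d : measure_display) (T : measurableType d) (P : probability T R)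
    (A : 'I_n * 'I_p -> T -> R),
  gaussian_families_exist (R := R) -> gaussian_family P A -> (p <= n)%N ->
  1 <= (n - p).+1%:R ^+ 2 * gram_cumulant n p 1 ->
  exists2 x : R,
    ('E_P[(fun w => (standardize P (fun w => ln (\det (gram (fun rj => A rj w)))) w ^+ k)%R)]
      = x%:E)%E &
    `|x - k`!%:R * g k| <= C / ((n - p).+1%:R ^+ 2 * gram_cumulant n p 1).
Proof.
move=> ke.
pose c j : R := 3 * 2 ^+ j.-1.
have c0 j : 0 <= c j by rewrite mulr_ge0// exprn_ge0.
have [C C0 HC] := moments_near_normal c0 hg k.
exists (k`!%:R * C); first by rewrite mulr_ge0.
move=> n p d T P A Hex gA pn.
set a := (n - p).+1%:R; set V := gram_cumulant n p 1 => aV.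
have a0 : 0 < a by [].
have V0 : 0 < V.
  have : 0 < a ^+ 2 * V by apply: lt_le_trans aV.
  by rewrite pmulr_rgt0// exprn_gt0.
set Y := fun w => ln _.
have [HY _] := gram_has_moments (@log_chi_square_has_moments R) pn gA.
rewrite -/Y in HY; set m := gram_log_moments _ _ _ in HY.
have Km := gram_cumulantP pn; rewrite -/m in Km.
set K := gram_cumulant n p in V aV V0 Km *.
set s := Num.sqrt V; have s0 : 0 < s by rewrite sqrtr_gt0.
have ss : s ^+ 2 = V by rewrite sqr_sqrtr// ltW.
have EY : ('E_P[Y] = (m 1%N)%:E)%E.
  by rewrite unlock; have [_ /(_ 1%N)[_]] := HY; rewrite mul1r.
have m1K : m 1%N = K 0%N.
  by case: Km => m0 /(_ 0%N); rewrite big_ord1 mul1r m0 mulr1.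
have HY' := has_moments_shift (- m 1%N) HY.
set m' := cauchy_prod _ m in HY'.
(* Adding the constant - m 1 cancels the cumulant of index 0 and leaves the others unchanged. *)
have Km' := cumulantsD (cumulants_exp (- m 1%N)) Km; rewrite -[cauchy_prod _ _]/m' in Km'.
set K' := (fun j => _ + _) in Km'.
have K'0 : K' 0%N = 0 by rewrite /K' /= m1K addNr.
have K'S j : K' j.+1 = K j.+1 by rewrite /K' /= add0r.
have VY : ('V_P[Y] = V%:E)%E.
  rewrite /variance unlock EY /=.
  have [_ /(_ 2%N)[_]] := HY'.
  have -> : 2`!%:R * m' 2 = V.
    have [m'0 /(_ 1%N)] := Km'.
    by rewrite !big_ord_recr big_ord0 /= K'0 mul0r !add0r m'0 mulr1 K'S.
  move=> <-; rewrite unlock; apply: eq_integral => w _.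
  by congr EFin; rewrite expr2 /= addrC.
have SE w : standardize P Y w ^+ k = (s ^+ k)^-1 * (- m 1%N + Y w) ^+ k.
  by rewrite /standardize EY VY /= -/s expr_div_n mulrC addrC.
have sK := cumulants_scale (lt0r_neq0 s0) Km'.
exists (k`!%:R * (m' k / s ^+ k)).
  rewrite unlock; under eq_integral do rewrite SE EFinM.
  have [_ /(_ k)[iY' EY']] := HY'.
  by rewrite integralZl// EY' -EFinM mulrC mulrA.
have as0 : 0 < a * s by rewrite mulr_gt0.
have das : 0 <= (a * s)^-1 <= 1.
  rewrite invr_ge0 (ltW as0) /= invf_le1//.
  by rewrite -(@expr_ge1 _ 2) ?(ltW as0)// exprMn ss.
have [||j j2|_] := HC (a * s)^-1 _ _ das _ _ _ sK.
- by rewrite K'0 mul0r.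
- by rewrite K'S ss divff// gt_eqF.
- case: j j2 => // i _ /=; rewrite K'S normrM normfV (ger0_norm (exprn_ge0 _ (ltW s0))).
  rewrite ler_pdivrMr ?exprn_gt0//.
  apply: le_trans (gram_cumulant_le n p i Hex) _.
  rewrite -/a (_ : gram_cumulant n p 1 = s ^+ 2); last by rewrite ss.
  rewrite exprVn exprMn /c /= !(exprS s).
  by rewrite le_eqVlt; apply/orP; left; apply/eqP; field; rewrite !expf_neq0 ?gt_eqF.
rewrite (negbTE ke) => H.
rewrite -mulrBr normrM ger0_norm// -mulrA ler_wpM2l//.
by apply: le_trans H _; rewrite exprVn exprMn ss.
Qed.

(** N^2 is chi-square with one degree of freedom, so E N^(2h) is the ratio of [log_moment (2 * h) 0]
    and [log_moment 0 0]. At i = 0 [log_moment_rec] gives the recursion that the cumulant relation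
    imposes on [g]. *)
Lemma even_moment_standard_normal (d : measure_display) (T : measurableType d)
    (P : probability T R) (N : {RV P >-> R}) (k : nat) :
  standard_normal N -> ~~ odd k ->
  ('E_P[(fun w => (N w ^+ k)%R)] = (k`!%:R * g k)%:E)%E.
Proof.
move=> hN ke.
have gN : gaussian_family P (fun (_ : 'I_1) => N : T -> R).
  split=> [i|B mB]; first exact: measurable_funPT.
  rewrite big_ord1 -hN// /distribution /pushforward.
  congr (P _); apply/seteqP; split=> w /=; first exact.
  by move=> h i; rewrite ord1.
have [h ->] : exists h, k = (2 * h)%N.
  by exists k./2; rewrite mul2n; have := odd_double_half k; rewrite (negbTE ke).
have ig i : (@lebesgue_measure R).-integrable `]0%R, +oo[%classic
    (fun r => ((r ^+ 2) ^+ i * chi_kernel 0 r)%:E).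
  have := @integrable_log_power R (2 * i) 0; apply: eq_integrable => //.
  move=> r; rewrite inE /= in_itv /= andbT => r0.
  by rewrite /log_power /chi_kernel !expr0 !mul1r exprM.
have [_ HE] := chi_square_expectation gN (exprn_measurable h) (ig h).
rewrite unlock.
have -> : (\int[P]_w (N w ^+ (2 * h))%:E = \int[P]_w ((\sum_(i < 1) N w ^+ 2) ^+ h)%:E)%E.
  by apply: eq_integral => w _; rewrite big_ord1 exprM.
rewrite HE.
have -> : (\int[lebesgue_measure]_(r in `]0%R, +oo[) ((r ^+ 2) ^+ h * chi_kernel 0 r)%:E =
    (log_moment (2 * h) 0 : R)%:E)%E.
  rewrite -log_momentE; apply: eq_integral => r; rewrite inE /= in_itv /= andbT => r0.
  by rewrite /log_power /chi_kernel !expr0 !mul1r exprM.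
rewrite -EFinM; congr EFin.
elim: h {HE} => [|h IH].
  by rewrite muln0 fact0 mul1r hg.1 mulVf// gt_eqF// log_moment0_gt0.
rewrite mulnS add2n log_moment_rec mulr0 mul0r addr0 mulrCA IH.
rewrite (factS (2 * h).+1) factS !natrM.
have [_ /(_ (2 * h).+1)] := hg.
rewrite 2!big_ord_recl /= mul0r add0r mul1r big1 ?addr0; last by move=> j _; rewrite mul0r.
rewrite subSS subn0 => <-; ring.
Qed.

End gram_cumulants.

(** * The matrix model and the growth of the variance in the two regimes *)

Section gaussian_matrix.
Context {R : realType}.

Lemma gaussian_matrix_family (d : measure_display) (T : measurableType d)
    (P : probability T R) (n m : nat) (A : 'I_n -> 'I_m -> {RV P >-> R}) :
  standard_gaussian_matrix A ->
  gaussian_family P (fun (ij : 'I_n * 'I_m) w => A ij.1 ij.2 w).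
Proof.
move=> [iA gA]; split=> [ij|B mB]; first exact: measurable_funPT.
have H := iA [set: 'I_n * 'I_m]%SET B (fun i _ => mB i).
transitivity (P (\bigcap_(i in [set` [set: 'I_n * 'I_m]%SET]) (A i.1 i.2 @^-1` B i))).
  by congr (P _); apply/seteqP; split=> w h i //=; apply: h; rewrite /= finset.in_setT.
rewrite H; apply: eq_big => [i|i _]; first by rewrite finset.in_setT.
exact: gA.
Qed.

Lemma log_det_laguerreE (d : measure_display) (T : measurableType d)
    (P : probability T R) (n m : nat) (A : 'I_n -> 'I_m -> {RV P >-> R}) :
  log_det_laguerre A = (fun w => ln (\det (gram (fun ij => A ij.1 ij.2 w)))).
Proof.
apply/funext => w; rewrite /log_det_laguerre /laguerre; congr (ln (\det _)).
by apply/matrixP => j k; rewrite !mxE; apply: eq_bigr => r _; rewrite !mxE.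
Qed.

Lemma sum_inverse_ge_card (n p : nat) : (0 < n)%N -> (p <= n)%N ->
  p%:R / n%:R <= \sum_(n - p <= q < n) q.+1%:R^-1 :> R.
Proof.
move=> n0 pn.
have -> : p%:R / n%:R = \sum_(n - p <= q < n) n%:R^-1 :> R.
  by rewrite sumr_const_nat subKn// mulr_natl.
apply: ler_sum_nat => q /andP[_ qn].
by rewrite lef_pV2 ?posrE ?ltr0n// ler_nat.
Qed.

(** The logarithm telescopes, and ln(1 + 1/b) <= 1/b bounds each increment. *)
Lemma sum_inverse_ge_ln (n m : nat) : (m <= n)%N ->
  ln (n.+1%:R / m.+1%:R) <= \sum_(m <= q < n) q.+1%:R^-1 :> R.
Proof.
move=> /subnKC <-; elim: (n - m)%N => [|l IH].
  by rewrite addn0 big_geq// divff// ln1.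
rewrite addnS big_nat_recr ?leq_addr//=.
have -> : (m + l).+2%:R / m.+1%:R = ((m + l).+1%:R / m.+1%:R) * (1 + (m + l).+1%:R^-1) :> R.
  have -> : (m + l).+2%:R = (m + l).+1%:R + 1 :> R by rewrite natr1.
  have : (m + l).+1%:R != 0 :> R by [].
  have : m.+1%:R != 0 :> R by [].
  move: (m.+1%:R) ((m + l).+1%:R) => a b a0 b0.
  by field; rewrite a0 b0.
rewrite lnM ?posrE ?divr_gt0 ?addr_gt0 ?invr_gt0//; apply: lerD => //.
by apply: le_ln1Dx; apply: (@lt_trans _ _ 0); rewrite ?invr_gt0// ltrN10.
Qed.

(** The sequence consists of the coefficients of exp(t^2 / 2). *)
Lemma cumulants_gaussian : cumulants (fun j => (j == 1%N)%:R : R)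
  (fun i => if odd i then 0 else (2 ^+ i./2 * (i./2)`!%:R)^-1).
Proof.
split=> [|[|i]]; first by rewrite /= expr0 mul1r invr1.
  by rewrite big_ord1 /= mulr0 mul0r.
rewrite 2!big_ord_recl /= mul0r add0r mul1r big1 ?addr0; last by move=> j _; rewrite mul0r.
rewrite subSS subn0 negbK; case: ifP => io; first by rewrite mulr0.
have -> : i.+2%:R = 2 * (i./2).+1%:R :> R.
  by rewrite -natrM mul2n doubleS -[in LHS](odd_double_half i) io.
rewrite exprS factS natrM.
have f0 := @fact_neq0 R i./2; have h0 : (i./2).+1%:R != 0 :> R by [].
have p0 : 2 ^+ i./2 != 0 :> R by rewrite expf_neq0.
move: ((i./2).+1%:R) (_ ^+ _) (_`!%:R) h0 p0 f0 => a b c a0 b0 c0.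
by field; rewrite a0 b0 c0.
Qed.

(** The common content of the two growth conditions in the first case: n - p is at least a fixed
    fraction of n. The fraction is 1/2 when p = o(n) and (1 - c)/2 when p ~ c n. *)
Lemma proportional_lt1 (p : nat -> nat) :
  ((fun n => (p n)%:R : R) =o_\oo (fun n => n%:R : R) \/
   exists c : R, 0 < c < 1 /\
     (fun n => (p n)%:R : R) ~_\oo (fun n => c * n%:R : R)) ->
  exists2 e : R, 0 < e & \forall n \near \oo, (p n)%:R <= (1 - e) * n%:R.
Proof.
case=> [/eqoP H|[c [/andP[c0 c1]]]].
  exists 2^-1 => //; near=> n.
  have : `|(p n)%:R| <= 2^-1 * `|n%:R| :> R by near: n; apply: H.
  by rewrite !ger0_norm//; lra.
move=> /eqaddoP H; exists ((1 - c) / 2); first by rewrite divr_gt0// subr_gt0.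
have e0 : 0 < (1 - c) / 2 by rewrite divr_gt0// subr_gt0.
near=> n.
have : `|(p n)%:R - c * n%:R| <= (1 - c) / 2 * `|c * n%:R| by near: n; apply: H.
rewrite (@ger0_norm _ (c * n%:R)) ?mulr_ge0 ?(ltW c0)// => h.
have h1 := le_trans (ler_norm _) h.
have n0 : 0 <= n%:R :> R by [].
have h2 : (1 - c) / 2 * (c * n%:R) <= (1 - c) / 2 * n%:R.
  by apply: ler_wpM2l; [exact: ltW|rewrite ler_piMl// ltW].
by have : (1 - (1 - c) / 2) * n%:R = c * n%:R + (1 - c) / 2 * n%:R :> R by [field]; lra.
Unshelve. all: by end_near.
Qed.

(** Eventually n - p and 1 are both at most n / (2 exp 1), so n - p + 1 <= n / exp 1. *)
Lemma gap_inverse_large (p : nat -> nat) :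
  (forall n, (0 < n)%N -> (p n <= n)%N) ->
  (fun n => n%:R - (p n)%:R : R) =o_\oo (fun n => n%:R : R) ->
  \forall n \near \oo, 1 <= ln (n%:R / (n%:R - (p n)%:R + 1)) :> R.
Proof.
move=> pn /eqoP H.
have e0 : 0 < expR (-1) / 2 :> R by rewrite divr_gt0 ?expR_gt0.
near=> n.
have n0 : (0 < n)%N by near: n; exact: nbhs_infty_gt.
have h1 : `|n%:R - (p n)%:R| <= expR (-1) / 2 * `|n%:R| :> R by near: n; apply: H.
have h2 : 2 * expR 1 <= n%:R :> R by near: n; exact: nbhs_infty_ger.
have q0 : 0 <= n%:R - (p n)%:R :> R by rewrite subr_ge0 ler_nat pn.
have a0 : 0 < n%:R - (p n)%:R + 1 :> R by rewrite ltr_wpDl.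
rewrite -[leLHS](expRK 1) ler_ln ?posrE ?expR_gt0 ?divr_gt0 ?ltr0n//.
rewrite ler_pdivlMr//.
have E : expR 1 * expR (-1) = 1 :> R by rewrite -expRD subrr expR0.
move: h1; rewrite (ger0_norm q0) (@ger0_norm _ n%:R)// => h1.
have h3 := ler_wpM2l (expR_ge0 1) h1.
have h4 : expR 1 * (expR (-1) / 2 * n%:R) = n%:R / 2 :> R by rewrite !mulrA E; ring.
by rewrite mulrDr mulr1; lra.
Unshelve. all: by end_near.
Qed.

End gaussian_matrix.

Theorem theorem6p2 (R : realType)
    (p : nat -> nat) (hp : forall n : nat, (0 < n)%N -> (1 <= p n <= n)%N)
    (d : nat -> measure_display) (T : forall n : nat, measurableType (d n))
    (P : forall n : nat, probability (T n) R)
    (A : forall n : nat, 'I_n -> 'I_(p n) -> {RV (P n) >-> R})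
    (hA : forall n : nat, (0 < n)%N -> standard_gaussian_matrix (A n))
    (d' : measure_display) (T' : measurableType d') (P' : probability T' R)
    (N : {RV P' >-> R}) (hN : standard_normal N)
    (k : nat) (hk : (0 < k)%N) (hke : ~~ odd k) :
  (((fun n : nat => (p n)%:R : R) =o_\oo (fun n : nat => n%:R : R) \/
    exists c : R, 0 < c < 1 /\
      (fun n : nat => (p n)%:R : R) ~_\oo (fun n : nat => c * n%:R : R)) ->
   exists C1 : R, \forall n \near \oo,
     (`| 'E_(P n)[(fun w => (ZL (A n) w ^+ k)%R)] - 'E_P'[(fun w => (N w ^+ k)%R)] |
       <= (C1 * (1 / ((p n)%:R * n%:R)))%R%:E)%E)
  /\
  ((fun n : nat => n%:R - (p n)%:R : R) =o_\oo (fun n : nat => n%:R : R) ->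
   exists C1 : R, \forall n \near \oo,
     (`| 'E_(P n)[(fun w => (ZL (A n) w ^+ k)%R)] - 'E_P'[(fun w => (N w ^+ k)%R)] |
       <= (C1 * (1 / ln (n%:R / (n%:R - (p n)%:R + 1))))%R%:E)%E).
Proof.
(* The first column of the matrix of size n + 1 is a Gaussian family with n + 1 members; it exists
   since p(n + 1) >= 1. *)
have Hex : gaussian_families_exist (R := R).
  move=> n; have [p0 _] := andP (hp n.+1 (ltn0Sn n)).
  exists (d n.+1), (T n.+1), (P n.+1), (fun i => A n.+1 i (Ordinal p0)).
  have h_inj : injective (fun i : 'I_n.+1 => (i, Ordinal p0)) by move=> i j [].
  exact: (gaussian_family_sub (gaussian_matrix_family (hA n.+1 (ltn0Sn n))) h_inj).
have [C C0 HC] := gram_standardized_moment (@cumulants_gaussian R) hke.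
pose a n : R := (n - p n).+1%:R.
pose V n : R := gram_cumulant n (p n) 1.
have Vge n : 2 * (\sum_(n - p n <= q < n) q.+1%:R^-1) <= V n by exact: gram_cumulant1_ge.
have aE n : (0 < n)%N -> a n = n%:R - (p n)%:R + 1.
  by move=> n0; have /andP[_ pn] := hp n n0; rewrite /a -natr1 natrB.
have key n B : (0 < n)%N -> 1 <= a n ^+ 2 * V n -> C / (a n ^+ 2 * V n) <= B ->
  (`| 'E_(P n)[(fun w => (ZL (A n) w ^+ k)%R)] - 'E_P'[(fun w => (N w ^+ k)%R)] | <= B%:E)%E.
  move=> n0 aV HB; have /andP[_ pn] := hp n n0.
  have [x Ex Hx] := HC n (p n) _ _ _ _ Hex (gaussian_matrix_family (hA n n0)) pn aV.
  rewrite /ZL log_det_laguerreE Ex (even_moment_standard_normal (@cumulants_gaussian R) hN hke).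
  by rewrite -EFinB lee_fin; apply: le_trans HB.
split=> H.
  have [e e0 He] := proportional_lt1 H.
  (* From a >= e n and V >= 2 p / n follows a^2 V >= 2 e^2 p n, which is at least 1 once n >= 1 / (2
     e^2). *)
  exists (C / (2 * e ^+ 2)); near=> n.
  have n0 : (0 < n)%N by near: n; exact: nbhs_infty_gt.
  have /andP[p1 pn] := hp n n0.
  have nR : 0 < n%:R :> R by rewrite ltr0n.
  have pR : 1 <= (p n)%:R :> R by rewrite ler1n.
  have h1 : (p n)%:R <= (1 - e) * n%:R by near: n.
  have h2 : (2 * e ^+ 2)^-1 <= n%:R by near: n; exact: nbhs_infty_ger.
  have e2 : 0 < 2 * e ^+ 2 by rewrite mulr_gt0// exprn_gt0.
  have ae : e * n%:R <= a n by rewrite aE//; lra.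
  have Vp : 2 * ((p n)%:R / n%:R) <= V n.
    by apply: le_trans (Vge n); rewrite ler_wpM2l// sum_inverse_ge_card.
  have aV : 2 * e ^+ 2 * ((p n)%:R * n%:R) <= a n ^+ 2 * V n.
    have -> : 2 * e ^+ 2 * ((p n)%:R * n%:R) = (e * n%:R) ^+ 2 * (2 * ((p n)%:R / n%:R)).
      by field; rewrite gt_eqF.
    apply: ler_pM => //.
      by rewrite exprn_ge0// mulr_ge0// ltW.
    by rewrite lerXn2r ?nnegrE// ?mulr_ge0// ltW.
  have pn0 : 0 < (p n)%:R * n%:R :> R by rewrite mulr_gt0// (lt_le_trans ltr01).
  apply: key => //.
    apply: le_trans aV; rewrite mulrC -ler_pdivrMr// mul1r.
    by apply: le_trans h2 _; rewrite ler_peMl// ltW.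
  rewrite mul1r -mulrA ler_wpM2l// -invfM lef_pV2 ?posrE//.
    by apply: lt_le_trans aV; rewrite mulr_gt0.
  by rewrite mulr_gt0.
have HL := gap_inverse_large (fun n n0 => proj2 (andP (hp n n0))) H.
exists C; near=> n.
have n0 : (0 < n)%N by near: n; exact: nbhs_infty_gt.
have /andP[_ pn] := hp n n0.
have L1 : 1 <= ln (n%:R / (n%:R - (p n)%:R + 1)) :> R by near: n; exact: HL.
rewrite -aE// in L1 *.
have a1 : 1 <= a n by rewrite ler1n.
have a0 : 0 < a n by rewrite ltr0n.
have nR : 0 < n%:R :> R by rewrite ltr0n.
(* Since [a n] may be as small as 1, only a^2 >= 1 is used, and the growth comes from the variance
   alone. *)
have LV : ln (n%:R / a n) <= a n ^+ 2 * V n.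
  have h1 : ln (n%:R / a n) <= ln (n.+1%:R / a n).
    by rewrite ler_ln ?posrE ?divr_gt0// ler_pM2r ?invr_gt0// ler_nat.
  have h2 := @sum_inverse_ge_ln R _ _ (leq_subr (p n) n).
  have h3 : ln (n%:R / a n) <= V n by have := Vge n; rewrite -/(a n) in h2; lra.
  have V0 : 0 <= V n by lra.
  by apply: le_trans h3 _; rewrite ler_peMl ?exprn_ege1.
apply: key => //; first exact: le_trans LV.
rewrite mul1r ler_wpM2l// lef_pV2 ?posrE//.
  by apply: lt_le_trans LV; apply: lt_le_trans L1.
exact: lt_le_trans L1.
Unshelve. all: by end_near.
Qed.
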